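(* Let $n\ge4$ and $N=\binom{n-2}{2}$. The smooth toric variety $\bar F_n\subset(\mathbb{C}P^1)^N$ is the permutohedral toric variety $\chi(P_e^{n-3})$, that is, the toric variety over the $(n-3)$-dimensional permutohedron $P_e^{n-3}$.
   Context: $$\bar F_n=\{((c_{ij}:c'_{ij}))_{3\le i<j\le n}\in(\mathbb{C}P^1)^N : c_{ij}c'_{ik}c_{jk}=c'_{ij}c_{ik}c'_{jk}\ \text{for all } 3\le i<j<k\le n\}.$$ It is considered with the action of $(\mathbb{C}^* )^{n-3}$ given for $\mathbf{t}=(t_1,\ldots,t_{n-3})$ by $\mathbf{t}\cdot((c_{ij}:c'_{ij}))=((\rho_{ij}(\mathbf{t})c_{ij}:c'_{ij}))$, where $\rho_{3k}(\mathbf{t})=t_{k-3}$ for $4\le k\le n$ and $\rho_{ij}(\mathbf{t})=t_{j-3}/t_{i-3}$ for $4\le i<j\le n$. With this action $\bar F_n$ is a smooth toric variety. *)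

(* Defs.v *)
From HB Require Import structures.
From Stdlib Require Import Relations.
From mathcomp Require Import all_boot all_order all_algebra all_fingroup.
From mathcomp Require Import generic_quotient.
From mathcomp Require Import boolp classical_sets functions reals.
From mathcomp Require Import complex ring zify.

Set Implicit Arguments.
Unset Strict Implicit.
Unset Printing Implicit Defensive.

Import Order.TTheory GRing.Theory Num.Theory.
Local Open Scope classical_set_scope.
Local Open Scope quotient_scope.
Local Open Scope ring_scope.

(** A variety is given by its closed points together with a family of local
    fractions: [fraction D f] says that [D] is a basic Zariski-open set and
    that [f] restricts on [D] to a quotient of two elements of a coordinate
    ring, with a denominator that vanishes nowhere on [D].  The values of [f]
    outside [D] are irrelevant.  The Zariski topology and the sheaf of regular
    functions are the ones generated by the local fractions. *)
Record variety (K : Type) := Variety {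
  point :> Type ;
  fraction : set point -> (point -> K) -> Prop }.

Section Varieties.
Variable K : Type.
Implicit Types X Y : variety K.

Definition zariski_open X (U : set X) : Prop :=
  forall x, U x -> exists D f, [/\ fraction D f, D x & D `<=` U].

Definition regular X (U : set X) (f : X -> K) : Prop :=
  forall x, U x -> exists D g,
    [/\ fraction D g, D x & forall y, D y -> U y -> f y = g y].

Definition morphism X Y (phi : X -> Y) : Prop :=
  forall V : set Y, zariski_open V ->
    zariski_open (phi @^-1` V) /\
    forall f : Y -> K, regular V f -> regular (phi @^-1` V) (f \o phi).

Definition isomorphism X Y (phi : X -> Y) : Prop :=
  exists psi : Y -> X,
    [/\ cancel phi psi, cancel psi phi, morphism phi & morphism psi].

End Varieties.

Section Torus.
Variables (K : fieldType) (k : nat).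

Definition torus := {t : 'rV[K]_k | [forall a, t 0 a != 0]}.

(** The coordinate t_a, with a ranging over 1, ..., k. *)
Definition tcoord (t : torus) (a : nat) : K := oapp (val t 0) 1 (insub a.-1).

(** The character of weight [m], i.e. the Laurent monomial t^m. *)
Definition character (t : torus) (m : 'rV[int]_k) : K :=
  \prod_a val t 0 a ^ m 0 a.

Lemma tcoord_neq0 t a : tcoord t a != 0.
Proof.
rewrite /tcoord; case: insubP => [u _ _|_] /=; last exact: oner_neq0.
by have /forallP := valP t.
Qed.

Lemma character0 t : character t 0 = 1.
Proof. by rewrite /character big1 // => a _; rewrite mxE expr0z. Qed.

Lemma characterD t m m' :
  character t (m + m') = character t m * character t m'.
Proof.
rewrite /character -big_split; apply: eq_bigr => a _ /=.
by rewrite mxE expfzDr //; have /forallP := valP t.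
Qed.

End Torus.

Section ProjectiveLine.
Variable K : fieldType.

Definition homog := {v : K * K | v != (0, 0)}.

Definition proportional (v w : homog) : bool :=
  (val v).1 * (val w).2 == (val v).2 * (val w).1.

Lemma proportional_refl : reflexive proportional.
Proof. by move=> v; rewrite /proportional mulrC. Qed.

Lemma proportional_sym : symmetric proportional.
Proof.
by move=> v w; rewrite /proportional eq_sym mulrC [X in _ == X]mulrC.
Qed.

Lemma proportional_trans : transitive proportional.
Proof.
move=> [[b b'] /= nb] [[a a'] /= na] [[c c'] /= nc].
rewrite /proportional /= => /eqP ab /eqP bc.
have [b0|b0] := eqVneq b 0; last first.
  apply/eqP; apply: (mulfI b0).
  have -> : b * (a * c') = a * (b * c') by ring.
  have -> : b * (a' * c) = (a' * b) * c by ring.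
  by rewrite bc -ab mulrA.
have b'0 : b' != 0 by apply: contra nb => /eqP ->; rewrite b0.
apply/eqP; apply: (mulfI b'0).
have -> : b' * (a * c') = (a * b') * c' by ring.
have -> : b' * (a' * c) = a' * (b' * c) by ring.
by rewrite ab -bc mulrA.
Qed.

Definition proportional_equiv :=
  EquivRel proportional proportional_refl proportional_sym proportional_trans.

Definition P1 := {eq_quot proportional_equiv}.

Lemma dummy_homog_neq0 : ((1, 0) : K * K) != (0, 0).
Proof. by rewrite xpair_eqE oner_eq0. Qed.

(** The point (c : c'); the value at (0, 0) is a dummy. *)
Definition mkP1 (c c' : K) : P1 :=
  \pi_P1 (insubd (Sub (1, 0) dummy_homog_neq0 : homog) (c, c')).

Definition hcoord (x : P1) : K * K := val (repr x).

Lemma hcoord_neq0 x : hcoord x != (0, 0).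
Proof. exact: (valP (repr x)). Qed.

Lemma mkP1_eq c c' d d' : (c, c') != (0, 0) -> (d, d') != (0, 0) ->
  (mkP1 c c' = mkP1 d d') <-> c * d' = c' * d.
Proof.
move=> nc nd; rewrite /mkP1; split.
  by move/eqP; rewrite eqmodE /= /proportional !val_insubd nc nd => /eqP.
by move=> e; apply/eqP; rewrite eqmodE /= /proportional !val_insubd nc nd e.
Qed.

Lemma hcoordK x : mkP1 (hcoord x).1 (hcoord x).2 = x.
Proof.
rewrite /mkP1 /hcoord -surjective_pairing.
by rewrite -[RHS](reprK x) /insubd valK.
Qed.

Lemma hcoord_mkP1 c c' : (c, c') != (0, 0) ->
  exists2 a, a != 0 & hcoord (mkP1 c c') = (a * c, a * c').
Proof.
move=> nc; set x := mkP1 c c'.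
have := hcoordK x; have := hcoord_neq0 x.
case: (hcoord x) => d d' /= nd /mkP1_eq -/(_ nd nc) e.
have [c0|c0] := eqVneq c 0.
  have c'0 : c' != 0 by apply: contra nc => /eqP ->; rewrite c0.
  have d0 : d = 0.
    by move/eqP: e; rewrite c0 mulr0 mulf_eq0 (negbTE c'0) orbF => /eqP.
  exists (d' / c'); last by rewrite c0 mulr0 d0 divfK.
  rewrite mulf_neq0 ?invr_neq0 //.
  by apply: contra nd => /eqP ->; rewrite d0.
exists (d / c); last by rewrite divfK // mulrAC e mulfK.
rewrite mulf_neq0 ?invr_neq0 //; apply: contra nd => /eqP d0.
move/eqP: e; rewrite d0 mul0r eq_sym mulf_eq0 (negbTE c0) orbF => /eqP ->.
by [].
Qed.

End ProjectiveLine.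

Section Fbar.
Variables (K : fieldType) (n : nat).

Definition pairs := {ij : 'I_n.+1 * 'I_n.+1 | (3 <= ij.1 < ij.2)%N}.

Lemma card_pairs : #|{: pairs}| = 'C(n - 2, 2).
Proof.
have cnt (j : nat) : (j <= n)%N ->
    (\sum_(i < n.+1) (3 <= i < j) = j - 3)%N.
  move=> jn; rewrite -(big_mkord xpredT (fun i => nat_of_bool (3 <= i < j)%N)).
  have gen (l : nat) : (\sum_(0 <= i < l) (3 <= i < j) = minn l j - 3)%N.
    elim: l => [|l IH]; first by rewrite big_geq // min0n.
    rewrite big_nat_recr //= IH.
    by case: (leqP 3 l) => ? /=; [case: (ltnP l j) => ?|]; lia.
  by rewrite gen; lia.
have tot (m : nat) : (\sum_(0 <= j < m.+1) (j - 3) = 'C(m - 2, 2))%N.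
  elim: m => [|m IH]; first by rewrite big_nat1.
  rewrite big_nat_recr //= IH; case: m {IH} => [|[|m]] //.
  by rewrite !subSS !subn0 binS bin1 addnC.
rewrite card_sig -sum1_card big_mkcond /= -tot big_mkord.
have -> : (\sum_(j < n.+1) (j - 3) =
           \sum_(j < n.+1) \sum_(i < n.+1) (3 <= i < j))%N.
  by apply: eq_bigr => j _; rewrite cnt // -ltnS.
rewrite exchange_big pair_bigA /=; apply: eq_bigr => ij _.
by rewrite unfold_in /=; case: ifP.
Qed.

Definition fst_index (p : pairs) : nat := (val p).1.
Definition snd_index (p : pairs) : nat := (val p).2.

(** The triples (p, q, r) below are exactly the ((i,j), (i,k), (j,k)) with
    3 <= i < j < k <= n.  The relation is homogeneous in each of the three
    points, hence it does not depend on the choice made in [hcoord]. *)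
Definition Fbar_set : set (pairs -> P1 K) :=
  [set x | forall p q r : pairs,
     fst_index p = fst_index q ->
     snd_index p = fst_index r ->
     snd_index q = snd_index r ->
     (hcoord (x p)).1 * (hcoord (x q)).2 * (hcoord (x r)).1 =
     (hcoord (x p)).2 * (hcoord (x q)).1 * (hcoord (x r)).2].

(** A multihomogeneous polynomial of multidegree [D] is a list of pairs made of
    a coefficient [a] and an exponent function [e] with [e p <= D p], standing
    for the monomial a * \prod_p c_p ^ (e p) * c'_p ^ (D p - e p). *)
Definition multihomogeneous (D : pairs -> nat)
    (g : seq (K * {ffun pairs -> nat})) : Prop :=
  forall ae, ae \in g -> forall p, (ae.2 p <= D p)%N.

Definition mh_eval (D : pairs -> nat) (g : seq (K * {ffun pairs -> nat}))
    (x : pairs -> P1 K) : K :=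
  \sum_(ae <- g) ae.1 * \prod_p
    ((hcoord (x p)).1 ^+ ae.2 p * (hcoord (x p)).2 ^+ (D p - ae.2 p)).

Definition Fbar_fraction (U : set (set_type Fbar_set))
    (f : set_type Fbar_set -> K) : Prop :=
  exists D g h, [/\ multihomogeneous D g, multihomogeneous D h,
    U = [set x | mh_eval D h (val x) != 0] &
    forall x, U x -> f x = mh_eval D g (val x) / mh_eval D h (val x)].

Definition Fbar : variety K := Variety Fbar_fraction.

Definition rho (t : torus K (n - 3)) (p : pairs) : K :=
  if fst_index p == 3%N then tcoord t (snd_index p - 3)
  else tcoord t (snd_index p - 3) / tcoord t (fst_index p - 3).

Definition Fbar_act_fun (t : torus K (n - 3)) (x : pairs -> P1 K) :
    pairs -> P1 K :=
  fun p => mkP1 (rho t p * (hcoord (x p)).1) (hcoord (x p)).2.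

Lemma rho_neq0 t p : rho t p != 0.
Proof.
rewrite /rho; case: ifP => _; first exact: tcoord_neq0.
by rewrite mulf_neq0 ?invr_neq0 ?tcoord_neq0.
Qed.

Lemma rhoM t p q r : fst_index p = fst_index q ->
  snd_index p = fst_index r -> snd_index q = snd_index r ->
  rho t p * rho t r = rho t q.
Proof.
move=> pq pr qr; rewrite /rho pq -pr -qr.
have /andP[p3 pp] := valP p.
have -> : (snd_index p == 3%N) = false.
  by apply/negbTE; rewrite neq_ltn (leq_ltn_trans p3 pp) orbT.
have nz : tcoord t (snd_index p - 3) != 0 by exact: tcoord_neq0.
by case: ifP => _; rewrite mulrC ?mulrA divfK.
Qed.

Lemma Fbar_act_subproof t (x : Fbar) :
  Fbar_act_fun t (val x) \in Fbar_set.
Proof.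
apply/mem_set => p q r pq pr qr; rewrite /Fbar_act_fun.
have nz s : (rho t s * (hcoord (val x s)).1, (hcoord (val x s)).2) != (0, 0).
  have := hcoord_neq0 (val x s); apply: contra.
  rewrite !xpair_eqE mulf_eq0 (negbTE (rho_neq0 t s)) /= => h.
  by rewrite [hcoord _]surjective_pairing xpair_eqE.
have [a _ ->] := hcoord_mkP1 (nz p).
have [b _ ->] := hcoord_mkP1 (nz q).
have [c _ ->] := hcoord_mkP1 (nz r) => /=.
have := set_mem (valP x); rewrite /Fbar_set /= => /(_ p q r pq pr qr).
rewrite -(rhoM t pq pr qr).
move: (hcoord _) (hcoord _) (hcoord _) (rho _ _) (rho _ _).
move=> [w w'] [v v'] [u u'] l k /= e.
have -> : a * (k * u) * (b * v') * (c * (l * w)) =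
          a * b * c * k * l * (u * v' * w).
  by ring.
by rewrite e; ring.
Qed.

Definition Fbar_act (t : torus K (n - 3)) (x : Fbar) : Fbar :=
  exist (fun y => y \in Fbar_set) _ (Fbar_act_subproof t x).

End Fbar.

(** A lattice polytope in R^d need not be full-dimensional.  Its inner normal fan is
    therefore taken in the dual of R^d, so that all its cones contain the linear
    space of functionals that are constant on the polytope.  This is the
    pull-back of the usual normal fan along the quotient by that linear space;
    the monoids [dual_monoid] below are unaffected by this pull-back. *)

Section Polytopes.
Variables (R : realType) (d : nat).
Implicit Types (u : 'rV[R]_d) (P F : set 'rV[R]_d).

Definition dotp u (x : 'rV[R]_d) : R := \sum_i u 0 i * x 0 i.

Definition convex_hull (I : finType) (v : I -> 'rV[R]_d) : set 'rV[R]_d :=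
  [set x | exists w : I -> R,
     [/\ forall i, 0 <= w i, \sum_i w i = 1 & x = \sum_i w i *: v i]].

Definition face P F : Prop :=
  exists u, F = [set x | P x /\ forall y, P y -> dotp u x <= dotp u y].

Definition normal_cone P F : set 'rV[R]_d :=
  [set u | forall x y, F x -> P y -> dotp u x <= dotp u y].

Definition normal_fan P : set (set 'rV[R]_d) :=
  [set sigma | exists F, [/\ face P F, F !=set0 & sigma = normal_cone P F]].

Definition permutohedron : set 'rV[R]_d :=
  convex_hull (fun s : 'S_d => \row_i (s i).+1%:R).

End Polytopes.

Arguments permutohedron R d : clear implicits.

Section ToricVarieties.
Variables (R : realType) (K : fieldType) (d : nat).
Variable Sigma : set (set 'rV[R]_d).
Implicit Types (sigma tau : set 'rV[R]_d) (m : 'rV[int]_d).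

(** The lattice points of the dual cone. *)
Definition dual_monoid sigma : set 'rV[int]_d :=
  [set m | forall u, sigma u -> 0 <= dotp u (map_mx intr m)].

(** The closed points of the affine toric variety U_sigma are the monoid
    homomorphisms from [dual_monoid sigma] to the multiplicative monoid of K;
    they are represented by their extensions by zero to the whole lattice. *)
Definition affine_point sigma (gamma : 'rV[int]_d -> K) : Prop :=
  [/\ gamma 0 = 1,
      forall m m', dual_monoid sigma m -> dual_monoid sigma m' ->
        gamma (m + m') = gamma m * gamma m' &
      forall m, ~ dual_monoid sigma m -> gamma m = 0].

Definition chart_point :=
  {p : set 'rV[R]_d * ('rV[int]_d -> K)
     | `[< Sigma p.1 /\ affine_point p.1 p.2 >]}.

(** The points of U_tau are identified with their images in U_sigma whenever
    [tau] is a cone of the fan contained in (hence a face of) the cone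
    [sigma]. *)
Definition glued (p q : chart_point) : Prop :=
  (val q).1 `<=` (val p).1 /\
  forall m, dual_monoid (val p).1 m -> (val p).2 m = (val q).2 m.

Definition glue_equiv (p q : chart_point) : bool :=
  `[< clos_refl_sym_trans _ glued p q >].

Lemma glue_equiv_refl : reflexive glue_equiv.
Proof. by move=> p; apply/asboolP; apply: rst_refl. Qed.

Lemma glue_equiv_sym : symmetric glue_equiv.
Proof. by move=> p q; apply/asboolP/asboolP; apply: rst_sym. Qed.

Lemma glue_equiv_trans : transitive glue_equiv.
Proof.
by move=> q p r /asboolP pq /asboolP qr; apply/asboolP; apply: rst_trans qr.
Qed.

Definition glue_equiv_rel :=
  EquivRel glue_equiv glue_equiv_refl glue_equiv_sym glue_equiv_trans.

Definition toric_point := {eq_quot glue_equiv_rel}.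

(** The value at [gamma] of the element \sum a * chi^m of the coordinate
    ring K[dual_monoid sigma] of U_sigma. *)
Definition chart_eval (g : seq (K * 'rV[int]_d)) (gamma : 'rV[int]_d -> K) : K :=
  \sum_(am <- g) am.1 * gamma am.2.

Definition chart_function sigma (g : seq (K * 'rV[int]_d)) : Prop :=
  forall am, am \in g -> dual_monoid sigma am.2.

Definition toric_fraction (U : set toric_point) (f : toric_point -> K) : Prop :=
  exists sigma g h,
    [/\ Sigma sigma, chart_function sigma g, chart_function sigma h,
        U = [set \pi_toric_point p | p in
              [set p : chart_point |
                 (val p).1 = sigma /\ chart_eval h (val p).2 != 0]] &
        forall p : chart_point,
          (val p).1 = sigma -> chart_eval h (val p).2 != 0 ->
          f (\pi_toric_point p) =
            chart_eval g (val p).2 / chart_eval h (val p).2].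

Definition toric_variety : variety K := Variety toric_fraction.

(** The torus of the toric variety is U_tau for the smallest cone [tau], the
    common linear space of the cones; its character lattice is
    [dual_monoid lineality]. *)
Definition lineality : set 'rV[R]_d :=
  [set u | forall sigma, Sigma sigma -> sigma u].

Definition character_lattice : set 'rV[int]_d := dual_monoid lineality.

Definition toric_torus :=
  {gamma : 'rV[int]_d -> K | `[< affine_point lineality gamma >]}.

Lemma toric_act_subproof (t : toric_torus) (p : chart_point) :
  `[< Sigma (val p).1 /\
      affine_point (val p).1 (fun m => val t m * (val p).2 m) >].
Proof.
have /asboolP[Sp [p0 pD pN]] := valP p.
have /asboolP[t0 tD tN] := valP t.
have sub m : dual_monoid (val p).1 m -> dual_monoid lineality m.
  by move=> hm u lu; apply: hm; apply: lu.
apply/asboolP; split=> //; split.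
- by rewrite t0 p0 mulr1.
- by move=> m m' hm hm'; rewrite tD ?pD //; [ring|exact: sub|exact: sub].
- by move=> m /pN ->; rewrite mulr0.
Qed.

(** (t . gamma) (m) = t (m) * gamma (m), in any chart. *)
Definition toric_act (t : toric_torus) (x : toric_variety) : toric_variety :=
  \pi_toric_point (exist _ ((val (repr (x : toric_point))).1, _)
                     (toric_act_subproof t (repr (x : toric_point)))).

(** The homomorphism from (K^* )^k to the torus of the toric variety dual to
    the homomorphism m |-> m A from its character lattice to Z^k. *)
Variable k : nat.

Definition dual_torus_fun (A : 'M[int]_(d, k)) (t : torus K k)
    (m : 'rV[int]_d) : K :=
  if `[< character_lattice m >] then character t (m *m A) else 0.

Lemma dual_torus_subproof A t : `[< affine_point lineality (dual_torus_fun A t) >].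
Proof.
have cD m m' : character_lattice m -> character_lattice m' ->
    character_lattice (m + m').
  move=> hm hm' u lu; have := addr_ge0 (hm u lu) (hm' u lu).
  rewrite /dotp -big_split /=; congr (_ <= _); apply: eq_bigr => i _.
  by rewrite !mxE rmorphD mulrDr.
apply/asboolP; rewrite /dual_torus_fun; split.
- case: asboolP => [_|[]]; first by rewrite mul0mx character0.
  move=> u _; rewrite /dotp big1 // => i _.
  by rewrite !mxE mulr0.
- move=> m m' hm hm'.
  by rewrite !asboolT ?mulmxDl ?characterD //; exact: cD.
- by move=> m hm; rewrite asboolF.
Qed.

Definition dual_torus (A : 'M[int]_(d, k)) (t : torus K k) : toric_torus :=
  exist (fun gamma => `[< affine_point lineality gamma >]) _
    (dual_torus_subproof A t).

End ToricVarieties.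

(* Main.v *)
(** Write [a = i - 3] for the index [i], so that indices run over [n - 2]
    elements, and read [(c_ij : c'_ij)] as [z_b / z_a].  The relations say that
    these ratios multiply, including the values [0] and infinity, so "[z_b / z_a]
    is finite" is a total preorder on the indices for every point.  Total
    preorders are exactly the cones of the normal fan of the permutohedron: the
    cone of [le] is [u_a <= u_b] whenever [le a b], and its dual monoid is
    generated by the roots [e_b - e_a] with [le a b].

    A point [gamma] of the chart of a cone is therefore determined by its values
    on these roots, which are to be the ratios [z_b / z_a]; this defines when a
    chart point represents a point of [Fbar].  Every chart point represents
    exactly one point, and all chart points that represent [x] are glued to the
    one in the chart of the preorder of [x], where [gamma] is a character on the
    invertible monomials and zero elsewhere.  This gives the bijection.  Both
    directions are regular because in each chart the ratios are monomials, and
    conversely the monomials are products of ratios. *)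

From Stdlib Require Import Relations.
Require Import Defs.
From mathcomp Require Import all_boot all_order all_algebra fingroup perm.
From mathcomp Require Import generic_quotient.
From mathcomp Require Import boolp classical_sets functions reals.
From mathcomp Require Import complex ring lra zify.

Set Implicit Arguments.
Unset Strict Implicit.
Unset Printing Implicit Defensive.

Import Order.TTheory GRing.Theory Num.Theory.
Local Open Scope classical_set_scope.
Local Open Scope quotient_scope.
Local Open Scope ring_scope.

(** * The normal fan of the permutohedron *)

Section BraidFan.
Variables (R : realType) (d : nat).
Implicit Types (u : 'rV[R]_d) (s : 'S_d) (le : rel 'I_d).

Lemma dotpDr u x y : dotp u (x + y) = dotp u x + dotp u y.
Proof.
by rewrite /dotp -big_split; apply: eq_bigr => i _ /=; rewrite mxE mulrDr.
Qed.

Lemma dotpNr u x : dotp u (- x) = - dotp u x.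
Proof.
by rewrite /dotp -sumrN; apply: eq_bigr => i _ /=; rewrite mxE mulrN.
Qed.

Lemma dotp_sumr u (I : finType) (w : I -> R) (v : I -> 'rV[R]_d) :
  dotp u (\sum_i w i *: v i) = \sum_i w i * dotp u (v i).
Proof.
rewrite /dotp; under eq_bigr do rewrite summxE mulr_sumr.
rewrite exchange_big; apply: eq_bigr => i _ /=.
by rewrite mulr_sumr; apply: eq_bigr => a _; rewrite mxE; ring.
Qed.

Definition cone le : set 'rV[R]_d :=
  [set u | forall a b, le a b -> u 0 a <= u 0 b].

Definition perm_vertex s : 'rV[R]_d := \row_i (s i).+1%:R.

(* The permutohedron is a translated zonotope: since [s a] counts the [b] with
   [s b < s a], the product [dotp u (perm_vertex s)] splits into independent
   contributions of the pairs [a != b].  Values are doubled, since each pair is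
   counted in both orders. *)
Definition min_value u : R :=
  \sum_a (u 0 a *+ 2 + \sum_(b | b != a) Num.min (u 0 a) (u 0 b)).

Definition antisorted u s : Prop :=
  forall a b, (s b < s a)%N -> u 0 a <= u 0 b.

Lemma card_perm_lt s a : #|[pred b | (s b < s a)%N]| = s a.
Proof.
rewrite -[RHS](card_ord (s a)) -!sum1_card.
rewrite (reindex_inj (@perm_inj _ s^-1%g)) /=.
under eq_bigl do rewrite inE permKV.
rewrite -(big_mkord (fun i => (i < s a)%N) (fun=> 1%N)).
have le_sa : (s a <= d)%N by apply: ltnW.
by rewrite (big_ord_widen _ (fun=> 1%N) le_sa) big_mkord.
Qed.

Lemma dotp_perm_vertex u s :
  dotp u (perm_vertex s) *+ 2 =
  \sum_a (u 0 a *+ 2 +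
          \sum_(b | b != a) (if (s b < s a)%N then u 0 a else u 0 b)).
Proof.
rewrite big_split /=.
have -> : \sum_a \sum_(b | b != a) (if (s b < s a)%N then u 0 a else u 0 b) =
   (\sum_a \sum_(b | b != a) (if (s b < s a)%N then u 0 a else 0)) *+ 2.
  rewrite mulr2n.
  transitivity (\sum_a \sum_(b | b != a) (if (s b < s a)%N then u 0 a else 0) +
     \sum_a \sum_(b | b != a) (if (s b < s a)%N then 0 else u 0 b)).
    rewrite -big_split; apply: eq_bigr => a _ /=; rewrite -big_split /=.
    by apply: eq_bigr => b _; case: ifP; rewrite ?addr0 ?add0r.
  (* Exchanging the roles of [a] and [b] turns the second double sum into the first. *)
  congr (_ + _); rewrite (exchange_big_dep xpredT) //=.
  apply: eq_bigr => a _; apply: eq_big => [b|b ba]; first by rewrite eq_sym.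
  have : s a != s b by rewrite (inj_eq perm_inj).
  by rewrite -val_eqE /=; case: ltngtP.
rewrite sumrMnl -mulrnDl; congr (_ *+ 2).
rewrite /dotp -big_split; apply: eq_bigr => a _ /=.
rewrite mxE -natr1 mulrDr mulr1 addrC; congr (_ + _).
rewrite -big_mkcondr /= -[in LHS](card_perm_lt s a) sumr_const.
rewrite mulr_natr; congr (_ *+ _); apply: eq_card => b; rewrite unfold_in /=.
by rewrite unfold_in; have [->|] := eqVneq b a; rewrite ?ltnn.
Qed.

Lemma min_value_le u s : min_value u <= dotp u (perm_vertex s) *+ 2.
Proof.
rewrite dotp_perm_vertex; apply: ler_sum => a _; rewrite lerD2l.
by apply: ler_sum => b _; case: ifP => _; rewrite ge_min lexx ?orbT.
Qed.

(** The doubled product exceeds [min_value u] by a sum of nonnegative terms, one for each ordered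
    pair of distinct indices, so equality forces each of them to vanish. *)
Lemma min_valueP u s :
  antisorted u s <-> dotp u (perm_vertex s) *+ 2 = min_value u.
Proof.
split=> [as_us|].
  rewrite dotp_perm_vertex; apply: eq_bigr => a _; congr (_ + _).
  apply: eq_bigr => b ba; case: ifP => [/as_us uab|]; first by case: leP uab.
  move/negbT; rewrite -leqNgt leq_eqVlt val_eqE (inj_eq perm_inj).
  by rewrite eq_sym (negbTE ba) /= => /as_us; case: ltgtP => // ->.
move=> /esym/eqP; rewrite eq_le => /andP[_]; rewrite dotp_perm_vertex.
rewrite -subr_le0 /min_value -sumrB => sum_le0 a b sba.
have term_ge0 c e : 0 <= (if (s e < s c)%N then u 0 c else u 0 e) -
    Num.min (u 0 c) (u 0 e).
  by rewrite subr_ge0; case: ifP => _; rewrite ge_min lexx ?orbT.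
have := sum_le0; rewrite (bigD1 a) //= => {}sum_le0.
have rest_ge0 : 0 <= \sum_(i < d | i != a)
     (u 0 i *+ 2 + \sum_(b | b != i) (if (s b < s i)%N then u 0 i else u 0 b) -
     (u 0 i *+ 2 + \sum_(b | b != i) Num.min (u 0 i) (u 0 b))).
  apply: sumr_ge0 => i _; rewrite opprD addrACA subrr add0r -sumrB.
  by apply: sumr_ge0.
have ba : b != a by apply: contraTneq sba => ->; rewrite ltnn.
move: sum_le0; rewrite opprD addrACA subrr add0r -sumrB (bigD1 b) //= sba.
have other_ge0 : 0 <= \sum_(e | (e != a) && (e != b))
    ((if (s e < s a)%N then u 0 a else u 0 e) - Num.min (u 0 a) (u 0 e)).
  by apply: sumr_ge0.
move: rest_ge0 other_ge0 => + + sum_le0.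
have -> : u 0 a <= u 0 b = (u 0 a - Num.min (u 0 a) (u 0 b) <= 0).
  by rewrite subr_le0 le_min lexx.
move: sum_le0; set x := _ - Num.min _ _; set y := \sum_(_ | _) _.
by set z := \sum_(_ | _) _; lra.
Qed.

(** The permutation sends [a] to the number of its strict successors, which decreases strictly along
    [lt]. *)
Lemma perm_of_order (lt : rel 'I_d) : irreflexive lt -> transitive lt ->
  (forall a b, a != b -> lt a b || lt b a) ->
  exists s : 'S_d, forall a b, (s b < s a)%N -> lt a b.
Proof.
move=> irr tr tot.
have bound a : (#|[set c | lt a c]%SET| < d)%N.
  rewrite -[X in (_ < X)%N]card_ord -cardsT; apply: proper_card.
  by rewrite properT; apply/eqP => /setP/(_ a); rewrite !inE irr.
have mono a b : lt a b -> (#|[set c | lt b c]%SET| < #|[set c | lt a c]%SET|)%N.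
  move=> ab; apply: proper_card; apply/properP; split.
    by apply/fintype.subsetP => c; rewrite !inE; apply: tr.
  by exists b; rewrite !inE ?ab ?irr.
have inj : injective (fun a => Ordinal (bound a)).
  move=> a b [] e; apply/eqP/negPn/negP => /tot.
  by case/orP => /mono; rewrite e ltnn.
exists (perm inj) => a b; rewrite !permE /= => ba.
have ab : a != b by apply: contraTneq ba => ->; rewrite ltnn.
by case/orP: (tot _ _ ab) => // /mono; rewrite ltnNge ltnW.
Qed.

(** Sort by [u] and break ties by [key], which puts [a] before all other indices of equal value;
    then [b] cannot precede [a]. *)
Lemma antisorted_exists u a b : a != b -> u 0 a <= u 0 b ->
  exists2 s, antisorted u s & (s b < s a)%N.
Proof.
move=> ab uab; pose key c := if c == a then 0%N else (val c).+1.
have key_inj : injective key.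
  move=> x y; rewrite /key; case: eqP => [->|_]; case: eqP => [->|_] //.
  by case=> /val_inj.
pose lt x y := (u 0 x < u 0 y) || (u 0 x == u 0 y) && (key x < key y)%N.
have irr : irreflexive lt by move=> x; rewrite /lt ltxx eqxx ltnn.
have tr : transitive lt.
  move=> y x z /orP[xy|/andP[/eqP xy kxy]] /orP[yz|/andP[/eqP yz kyz]];
    rewrite /lt.
  - by rewrite (lt_trans xy yz).
  - by rewrite -yz xy.
  - by rewrite xy yz.
  - by rewrite xy yz eqxx (ltn_trans kxy kyz) orbT.
have tot x y : x != y -> lt x y || lt y x.
  rewrite -(inj_eq key_inj) neq_ltn /lt => kxy.
  case: ltgtP => //= _; exact: kxy.
have [s sP] := perm_of_order irr tr tot; exists s.
  by move=> x y /sP/orP[/ltW|/andP[/eqP ->]].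
rewrite ltnNge leq_eqVlt negb_or val_eqE (inj_eq perm_inj) ab /=.
apply/negP => /sP; rewrite /lt ltNge uab /= => /andP[_].
by rewrite /key eqxx ltn0.
Qed.

Lemma antisorted_exists0 u : exists s, antisorted u s.
Proof.
case: (boolP [exists a, exists b, (a != b) && (u 0 a <= u 0 b)]).
  by case/existsP=> a /existsP[b /andP[/antisorted_exists h /h[s]]]; exists s.
move=> /existsPn no; exists 1%g => a b; rewrite !perm1 => ba.
have /existsPn/(_ b) := no a; rewrite negb_and -ltNge negbK.
case: eqVneq => [->//|ab /= lab].
have /existsPn/(_ a) := no b; rewrite negb_and -ltNge negbK eq_sym (negbTE ab).
by move=> /= /(lt_trans lab); rewrite ltxx.
Qed.

Lemma perm_vertex_in s : permutohedron R d (perm_vertex s).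
Proof.
exists (fun t => (t == s)%:R); split=> [t||]; first exact: ler0n.
  by rewrite (bigD1 s) //= eqxx big1 ?addr0 // => t /negbTE ->.
rewrite (bigD1 s) //= eqxx scale1r big1 ?addr0 // => t /negbTE ->.
by rewrite scale0r.
Qed.

Lemma min_value_lb u y : permutohedron R d y -> min_value u <= dotp u y *+ 2.
Proof.
case=> w [w0 w1 ->]; rewrite dotp_sumr -sumrMnl.
have -> : min_value u = \sum_s w s * min_value u by rewrite -mulr_suml w1 mul1r.
apply: ler_sum => s _; rewrite -mulrnAr; apply: ler_wpM2l => //.
exact: min_value_le.
Qed.

(** A point minimizing [u0] is a convex combination whose weights vanish off the vertices that
    minimize [u0]. Such vertices are antisorted for [u0], hence for [u], and so minimize [u] too. *)
Lemma dotp_face u0 u x : permutohedron R d x ->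
  dotp u0 x *+ 2 = min_value u0 ->
  (forall a b, u0 0 a <= u0 0 b -> u 0 a <= u 0 b) ->
  dotp u x *+ 2 = min_value u.
Proof.
case=> w [w0 w1 ->] + hu; rewrite !dotp_sumr -!sumrMnl => e.
have min_sum v : min_value v = \sum_s w s * min_value v.
  by rewrite -mulr_suml w1 mul1r.
have /eqP : \sum_s w s * (dotp u0 (perm_vertex s) *+ 2 - min_value u0) = 0.
  under eq_bigr do rewrite mulrBr mulrnAr.
  by rewrite sumrB e -min_sum subrr.
rewrite psumr_eq0 => [/allP z|s _]; last first.
  by rewrite mulr_ge0 // subr_ge0 min_value_le.
rewrite [RHS]min_sum; apply: eq_bigr => s _.
have := z s (mem_index_enum s); rewrite /= mulf_eq0 => /orP[/eqP ->|].
  by rewrite !mul0r mul0rn.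
rewrite subr_eq0 => /eqP/min_valueP as0; rewrite -mulrnAr; congr (_ * _).
by apply/min_valueP => a b /as0/hu.
Qed.

(** Each inequality of the cone is detected by a vertex of the face on which [b] is ranked below
    [a]; the converse inclusion is [dotp_face]. *)
Lemma face_normal_cone u0 F :
  F = [set x | permutohedron R d x /\
               forall y, permutohedron R d y -> dotp u0 x <= dotp u0 y] ->
  normal_cone (permutohedron R d) F = cone (fun a b => u0 0 a <= u0 0 b).
Proof.
move=> ->; rewrite eqEsubset; split=> u.
  move=> hu a b uab; have [->//|ab] := eqVneq a b.
  have [s as0 sba] := antisorted_exists ab uab.
  have [t /min_valueP et] := antisorted_exists0 u.
  suff /min_valueP/(_ a b sba) : dotp u (perm_vertex s) *+ 2 = min_value u by [].
  apply: le_anti; rewrite min_value_le andbT -et lerMn2r /=.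
  apply: hu (perm_vertex_in t); split; first exact: perm_vertex_in.
  move=> y Py; rewrite -(@ler_pMn2r _ 2) //; move/min_valueP: as0 => ->.
  exact: min_value_lb.
move=> hu x y [Px hx] Py; rewrite -(@ler_pMn2r _ 2) //.
have [t /min_valueP et] := antisorted_exists0 u0.
rewrite (dotp_face Px _ hu) ?min_value_lb //.
apply: le_anti; rewrite min_value_lb // andbT -et lerMn2r /=.
by apply: hx; apply: perm_vertex_in.
Qed.

(** For a total preorder, the vector of ranks induces exactly [le]; it serves as a functional
    selecting the face of [le] and as a test vector in the cone. *)
Definition rank le (a : 'I_d) : nat := #|[set c | le c a]%SET|.

Lemma rank_le le a b : total le -> transitive le ->
  (rank le a <= rank le b)%N = le a b.
Proof.
move=> tot tr; have rfl c : le c c by case/orP: (tot c c).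
case ab : (le a b).
  apply: subset_leq_card; apply/fintype.subsetP => c; rewrite !inE => ca.
  exact: tr ab.
apply/negbTE; rewrite -ltnNge; apply: proper_card; apply/properP.
have ba : le b a by case/orP: (tot a b) => //; rewrite ab.
split; last by exists a; rewrite !inE ?rfl ?ab.
by apply/fintype.subsetP => c; rewrite !inE => cb; apply: tr ba.
Qed.

Lemma normal_fan_permutohedron (sigma : set 'rV[R]_d) :
  normal_fan (permutohedron R d) sigma <->
  exists le, [/\ total le, transitive le & sigma = cone le].
Proof.
split=> [[F [[u0 eF] _ ->]]|[le [tot tr ->]]].
  exists (fun a b => u0 0 a <= u0 0 b); split.
  - by move=> a b; apply: le_total.
  - by move=> a b c; apply: le_trans.
  - exact: face_normal_cone.
pose u0 : 'rV[R]_d := \row_a (rank le a)%:R.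
eexists; split; first by exists u0.
  have [t /min_valueP et] := antisorted_exists0 u0.
  exists (perm_vertex t); split; first exact: perm_vertex_in.
  move=> y Py; rewrite -(@ler_pMn2r _ 2) // et; exact: min_value_lb.
rewrite (face_normal_cone erefl); congr cone.
apply/funext => a; apply/funext => b.
by rewrite !mxE ler_nat rank_le.
Qed.

End BraidFan.

(** * Generators of the dual monoids *)

Section RootGeneration.
Variable d : nat.
Implicit Types (le : rel 'I_d) (m : 'rV[int]_d).

Definition root (a b : 'I_d) : 'rV[int]_d := delta_mx 0 b - delta_mx 0 a.

Lemma rootN a b : - root a b = root b a.
Proof. by rewrite /root opprB. Qed.

Lemma rootD a b c : root a b + root b c = root a c.
Proof. by rewrite /root addrC addrA subrK. Qed.

Lemma root_refl a : root a a = 0.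
Proof. exact: subrr. Qed.

Variable R : realType.
Implicit Types (u : 'rV[R]_d) (sigma : set 'rV[R]_d).

Lemma dual_monoid0 sigma : dual_monoid sigma 0.
Proof. by move=> u _; rewrite /dotp big1 // => i _; rewrite !mxE mulr0. Qed.

Lemma dual_monoidD sigma m m' :
  dual_monoid sigma m -> dual_monoid sigma m' -> dual_monoid sigma (m + m').
Proof.
move=> hm hm' u su; rewrite map_mxD dotpDr.
by apply: addr_ge0; [apply: hm|apply: hm'].
Qed.

Lemma dual_monoid_sum (I : Type) (r : seq I) sigma (m : I -> 'rV[int]_d) :
  (forall i, dual_monoid sigma (m i)) -> dual_monoid sigma (\sum_(i <- r) m i).
Proof.
by move=> h; elim/big_ind: _ => //; [apply: dual_monoid0|apply: dual_monoidD].
Qed.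

Lemma dual_monoidMn sigma m k :
  dual_monoid sigma m -> dual_monoid sigma (m *+ k).
Proof.
move=> h; elim: k => [|k IH]; first exact: dual_monoid0.
by rewrite mulrS; apply: dual_monoidD.
Qed.

Lemma dotp_root u a b : dotp u (map_mx intr (root a b)) = u 0 b - u 0 a.
Proof.
have dotp_delta c : dotp u (delta_mx 0 c) = u 0 c.
  rewrite /dotp (bigD1 c) //= mxE !eqxx mulr1 big1 ?addr0 // => i /negbTE ni.
  by rewrite mxE ni andbF mulr0.
by rewrite /root map_mxB dotpDr dotpNr !map_delta_mx !dotp_delta.
Qed.

Lemma dual_cone_root le a b : total le -> transitive le ->
  dual_monoid (cone (R := R) le) (root a b) <-> le a b.
Proof.
move=> tot tr; split=> [h|ab u hu].
  have /h : cone (R := R) le (\row_c (rank le c)%:R).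
    by move=> c e ce; rewrite !mxE ler_nat rank_le.
  by rewrite dotp_root subr_ge0 !mxE ler_nat rank_le.
by rewrite dotp_root subr_ge0; apply: hu.
Qed.

(** Constant vectors of either sign lie in every cone. *)
Lemma dual_cone_sum0 le m : dual_monoid (cone (R := R) le) m -> \sum_a m 0 a = 0.
Proof.
move=> h; have cst (c : R) : cone le (const_mx c) by move=> a b _; rewrite !mxE.
have e (c : R) : dotp (const_mx c) (map_mx intr m) = c * (\sum_a m 0 a)%:~R.
  rewrite /dotp rmorph_sum mulr_sumr.
  by apply: eq_bigr => a _; rewrite !mxE.
apply/eqP; rewrite -(intr_eq0 R) eq_le; apply/andP; split.
  by have := h _ (cst (-1)); rewrite e mulN1r oppr_ge0.
by have := h _ (cst 1); rewrite e mul1r.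
Qed.

(** The indicator vector of an upper set of [le] lies in the cone. *)
Lemma dual_cone_upper_sum le m b : transitive le ->
  dual_monoid (cone (R := R) le) m -> 0 <= \sum_(c | le b c) m 0 c.
Proof.
move=> tr h; have /h : cone (R := R) le (\row_c (le b c)%:R).
  move=> c e ce; rewrite !mxE; case bc : (le b c) => //=.
  by rewrite (tr _ _ _ bc ce).
rewrite /dotp; have -> : \sum_i (\row_c (le b c)%:R : 'rV[R]_d) 0 i *
    (map_mx intr m : 'rV[R]_d) 0 i = (\sum_(c | le b c) m 0 c)%:~R.
  rewrite rmorph_sum [RHS]big_mkcond; apply: eq_bigr => c _ /=.
  by rewrite !mxE; case: (le b c); rewrite ?mul1r ?mul0r.
by rewrite ler0z.
Qed.

(* Abel summation along a [le]-increasing enumeration of the indices: [m] is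
   the sum of the simple roots of the enumeration, weighted by the sums of the
   final segments of [m]. *)
Lemma dual_cone_ind le (G : 'rV[int]_d -> Prop) : total le -> transitive le ->
  G 0 -> (forall m m', G m -> G m' -> G (m + m')) ->
  (forall a b (z : int), (0 < z -> le a b) -> (z < 0 -> le b a) ->
     G (root a b *~ z)) ->
  forall m, dual_monoid (cone (R := R) le) m -> G m.
Proof.
move=> tot tr G0 GD Groot m hm.
have pe : perm_eq (sort le (enum 'I_d)) (index_enum 'I_d).
  apply: uniq_perm; rewrite ?sort_uniq ?enum_uniq ?index_enum_uniq // => c.
  by rewrite mem_sort mem_enum mem_index_enum.
pose T (s : seq 'I_d) := \sum_(c <- s) m 0 c.
(* For every final segment [s], the part of [m] supported on [s], corrected at the preceding index
   [a0] to have sum zero, satisfies [G]. *)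
have key s : forall pre a0, sort le (enum 'I_d) = pre ++ a0 :: s ->
    G (\sum_(c <- s) (delta_mx 0 c *~ m 0 c) - delta_mx 0 a0 *~ T s).
  elim: s => [|b s IH] pre a0 es.
    by rewrite /T !big_nil mulr0z subr0.
  have := IH (rcons pre a0) b; rewrite cat_rcons => /(_ es) Gs.
  have sorted_s : pairwise le (sort le (enum 'I_d)).
    by rewrite -sorted_pairwise // sort_sorted.
  move: sorted_s; rewrite es pairwise_cat /= => /and3P[].
  move=> /allrelP le_pre pw_pre /andP[/andP[le_a0b _] /andP[/allP le_b _]].
  have -> : \sum_(c <- b :: s) (delta_mx 0 c *~ m 0 c) -
      delta_mx 0 a0 *~ T (b :: s) =
      (\sum_(c <- s) (delta_mx 0 c *~ m 0 c) - delta_mx 0 b *~ T s) +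
      root a0 b *~ T (b :: s) :> 'rV[int]_d.
    rewrite /T !big_cons /root mulrzBl !mulrzDr.
    by rewrite [X in _ + (X - _)]addrC !addrA subrK [X in _ = X - _]addrC.
  apply: GD => //; apply: Groot => // T_lt0.
  (* If [b] is not below [a0], the segment [b :: s] is exactly the upper set of [b], so its sum
     cannot be negative. *)
  apply: contraLR T_lt0 => nba0; rewrite -leNgt.
  have -> : T (b :: s) = \sum_(c | le b c) m 0 c; last first.
    exact: dual_cone_upper_sum.
  rewrite -(perm_big _ pe) /= es big_cat big_cons (negbTE nba0) /=.
  rewrite big_seq_cond big1 ?add0r => [|c /andP[cpre bc]]; last first.
    case/negP: nba0; apply: (tr c) => //.
    by apply: le_pre => //; rewrite mem_head.
  rewrite /T [RHS]big_seq_cond [LHS]big_seq; apply: eq_bigl => c.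
  case cs : (c \in _) => //=; move: cs; rewrite inE => /predU1P[->|/le_b ->//].
  by case/orP: (tot b b) => ->.
have sum_m : m = \sum_(c <- sort le (enum 'I_d)) (delta_mx 0 c *~ m 0 c).
  rewrite (perm_big _ pe).
  rewrite [LHS]row_sum_delta; apply: eq_bigr => c _.
  by rewrite -scaler_int intz.
case es : (sort le (enum 'I_d)) => [|a0 s].
  by rewrite sum_m es big_nil.
(* The entries of [m] sum to zero, so the correction at the first index [a0] is its true entry
   there. *)
have := key s [::] a0 es.
have := dual_cone_sum0 hm; rewrite -(perm_big _ pe) /= es big_cons.
move=> /eqP; rewrite addr_eq0 => /eqP m_a0.
suff <- : m = \sum_(c <- s) (delta_mx 0 c *~ m 0 c) - delta_mx 0 a0 *~ T s by [].
by rewrite {1}sum_m es big_cons m_a0 mulrNz addrC.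
Qed.

End RootGeneration.

(** * Ratios of ordered pairs of indices *)

Section PairIndices.
Variable n : nat.
Implicit Types (p q r : pairs n) (a b c : 'I_(n - 2)).

Lemma fst_index_bound p : (fst_index p - 3 < n - 2)%N.
Proof.
have /andP[h3 hlt] := valP p; have := ltn_ord (val p).2.
by rewrite /fst_index; lia.
Qed.

Lemma snd_index_bound p : (snd_index p - 3 < n - 2)%N.
Proof.
have /andP[h3 hlt] := valP p; have := ltn_ord (val p).2.
by rewrite /snd_index; lia.
Qed.

Definition pfst p : 'I_(n - 2) := Ordinal (fst_index_bound p).
Definition psnd p : 'I_(n - 2) := Ordinal (snd_index_bound p).

Lemma index_shift_bound a : (a.+3 < n.+1)%N.
Proof. by have := ltn_ord a; lia. Qed.

Definition index_shift a : 'I_n.+1 := Ordinal (index_shift_bound a).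

Definition pair_of a b : option (pairs n) := insub (index_shift a, index_shift b).

Lemma pair_of_pfst p : pair_of (pfst p) (psnd p) = Some p.
Proof.
rewrite /pair_of -[RHS](valK p); congr insub; apply/eqP.
have /andP[h3 hlt] := valP p.
rewrite -pair_eqE /= -!val_eqE /= /fst_index /snd_index.
by apply/andP; split; apply/eqP; rewrite -[sval p]/(val p); lia.
Qed.

Lemma pair_of_lt a b : (a < b)%N -> exists2 p, pfst p = a & psnd p = b.
Proof.
move=> ab; have h : (3 <= (index_shift a, index_shift b).1 <
                     (index_shift a, index_shift b).2)%N.
  by rewrite /=; lia.
exists (exist (fun ij : 'I_n.+1 * 'I_n.+1 => 3 <= ij.1 < ij.2)%N _ h);
  apply: val_inj => /=.
  by rewrite /fst_index /= subSS subn2.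
by rewrite /snd_index /= subSS subn2.
Qed.

Lemma pair_of_nlt a b : ~~ (a < b)%N -> pair_of a b = None.
Proof. by move=> ab; apply: insubN; rewrite /=; apply: contra ab; lia. Qed.

Lemma pfst_eq p q : pfst p = pfst q <-> fst_index p = fst_index q.
Proof.
have /andP[h3 _] := valP p; have /andP[k3 _] := valP q.
split=> [/(congr1 val) /=|e]; last by apply: val_inj; rewrite /= e.
by rewrite /fst_index; lia.
Qed.

Lemma psnd_eq p q : psnd p = psnd q <-> snd_index p = snd_index q.
Proof.
have /andP[h3 hl] := valP p; have /andP[k3 kl] := valP q.
split=> [/(congr1 val) /=|e]; last by apply: val_inj; rewrite /= e.
by rewrite /snd_index; lia.
Qed.

Lemma psnd_pfst_eq p q : psnd p = pfst q <-> snd_index p = fst_index q.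
Proof.
have /andP[h3 hl] := valP p; have /andP[k3 kl] := valP q.
split=> [/(congr1 val) /=|e]; last by apply: val_inj; rewrite /= e.
by rewrite /snd_index /fst_index; lia.
Qed.

Definition proot p : 'rV[int]_(n - 2) := root (pfst p) (psnd p).

(** For the order of a cone of the fan, this says that each single term [proot p *~ z p] already
    lies in the dual monoid. *)
Definition adapted (le : rel 'I_(n - 2)) (z : pairs n -> int) : Prop :=
  forall p, (0 < z p -> le (pfst p) (psnd p)) /\
            (z p < 0 -> le (psnd p) (pfst p)).

Lemma dual_cone_generated (R : realType) (le : rel 'I_(n - 2)) m :
  total le -> transitive le -> dual_monoid (cone (R := R) le) m ->
  exists2 z, adapted le z & m = \sum_p proot p *~ z p.
Proof.
move=> tot tr; move: m; apply: (dual_cone_ind tot tr) =>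
  [|m m' [z hz ->] [z' hz' ->]|a b z hz hz'].
- by exists (fun=> 0) => //; rewrite big1.
- exists (fun p => z p + z' p).
    move=> p; have [p1 p2] := hz p; have [p3 p4] := hz' p; split=> h.
      case: (ltP 0 (z p)) => [//|h1]; apply: p3; lia.
    case: (ltP (z p) 0) => [//|h1]; apply: p4; lia.
  by rewrite -big_split; apply: eq_bigr => p _; rewrite mulrzDr.
- have [ab|ba|ab] := ltngtP a b.
  + have [p pa pb] := pair_of_lt ab; exists (fun q => if q == p then z else 0).
      by move=> q; case: eqP => [->|//]; rewrite pa pb.
    by rewrite (bigD1 p) //= eqxx big1 ?addr0 /proot ?pa ?pb // => q /negbTE ->.
  + have [p pb pa] := pair_of_lt ba; exists (fun q => if q == p then - z else 0).
      by move=> q; case: eqP => [->|//]; rewrite pa pb oppr_gt0 oppr_lt0.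
    rewrite (bigD1 p) //= eqxx big1 ?addr0 /proot ?pa ?pb => [|q /negbTE -> //].
    by rewrite -rootN mulNrz mulrNz.
  + have -> : a = b by apply: val_inj.
    by exists (fun=> 0) => //; rewrite big1 // root_refl mul0rz.
Qed.

End PairIndices.

Section OrderedCoordinates.
Variables (K : fieldType) (n : nat).
Implicit Types (x : pairs n -> P1 K) (a b c : 'I_(n - 2)).

(* Homogeneous coordinates of [z_b / z_a] for an arbitrary ordered pair of
   indices; on the torus, the point [x p] is [z_(psnd p) / z_(pfst p)]. *)
Definition ratio x a b : K * K :=
  if pair_of a b is Some p then hcoord (x p)
  else if pair_of b a is Some p then ((hcoord (x p)).2, (hcoord (x p)).1)
  else (1, 1).

Lemma ratio_pair x p : ratio x (pfst p) (psnd p) = hcoord (x p).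
Proof. by rewrite /ratio pair_of_pfst. Qed.

Lemma ratio_refl x a : ratio x a a = (1, 1).
Proof. by rewrite /ratio pair_of_nlt ?ltnn. Qed.

Lemma ratio_sym x a b : ratio x b a = ((ratio x a b).2, (ratio x a b).1).
Proof.
rewrite /ratio; have [ab|ba|/val_inj ->] := ltngtP a b.
- rewrite [pair_of b a]pair_of_nlt -?leqNgt 1?ltnW //.
  by have [p <- <-] := pair_of_lt ab; rewrite pair_of_pfst.
- rewrite [pair_of a b]pair_of_nlt -?leqNgt 1?ltnW //.
  have [p <- <-] := pair_of_lt ba; rewrite pair_of_pfst /=.
  exact: surjective_pairing.
- by rewrite pair_of_nlt ?ltnn.
Qed.

Lemma ratio_neq0 x a b : ratio x a b != (0, 0).
Proof.
wlog ab : a b / (a <= b)%N => [hw|].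
  case/orP: (leq_total a b) => [/hw //|/hw]; rewrite ratio_sym; apply: contra.
  by move=> /eqP ->.
move: ab; rewrite leq_eqVlt => /orP[/eqP/val_inj ->|ab].
  by rewrite ratio_refl xpair_eqE oner_eq0.
have [p <- <-] := pair_of_lt ab; rewrite ratio_pair; exact: hcoord_neq0.
Qed.

Lemma ratio_fst_neq0 x a b : (ratio x a b).2 = 0 -> (ratio x a b).1 != 0.
Proof.
move=> e; apply: contra (ratio_neq0 x a b) => /eqP e1.
by rewrite [ratio x a b]surjective_pairing e e1.
Qed.

Definition cocycle x a b c : Prop :=
  (ratio x a b).1 * (ratio x a c).2 * (ratio x b c).1 =
  (ratio x a b).2 * (ratio x a c).1 * (ratio x b c).2.

Lemma cocycle_swap12 x a b c : cocycle x a b c -> cocycle x b a c.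
Proof.
rewrite /cocycle (ratio_sym x a b) /=.
move: (ratio x a b) (ratio x a c) (ratio x b c) => [? ?] [? ?] [? ?] /= e.
by ring: e.
Qed.

Lemma cocycle_swap23 x a b c : cocycle x a b c -> cocycle x a c b.
Proof.
rewrite /cocycle (ratio_sym x b c) /=.
move: (ratio x a b) (ratio x a c) (ratio x b c) => [? ?] [? ?] [? ?] /= e.
by ring: e.
Qed.

(** The relation is stable under both adjacent transpositions, hence under all permutations of the
    triple; it is trivial when two indices agree. *)
Lemma Fbar_cocycle x : Fbar_set x -> forall a b c, cocycle x a b c.
Proof.
move=> Fx.
have lt_case a b c : (a < b)%N -> (b < c)%N -> cocycle x a b c.
  move=> ab bc; have [p pa pb] := pair_of_lt ab.
  have [q qa qc] := pair_of_lt (ltn_trans ab bc).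
  have [r rb rc] := pair_of_lt bc.
  have := ratio_pair x p; have := ratio_pair x q; have := ratio_pair x r.
  rewrite /cocycle pa pb qa qc rb rc => -> -> ->; apply: Fx.
  - by apply/pfst_eq; rewrite pa.
  - by apply/psnd_pfst_eq; rewrite pb.
  - by apply/psnd_eq; rewrite rc.
have eq12 a c : cocycle x a a c.
  by rewrite /cocycle ratio_refl /= !mul1r mulrC.
have eq23 a b : cocycle x a b b.
  by rewrite /cocycle ratio_refl /= !mulr1 mulrC.
have eq13 a b : cocycle x a b a by apply: cocycle_swap23.
move=> a b c.
have [ab|ba|/val_inj ->//] := ltngtP a b;
  have [bc|cb|/val_inj ->//] := ltngtP b c;
  have [ac|ca|/val_inj ->//] := ltngtP a c; try (by exfalso; lia).
- exact: lt_case.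
- by apply: cocycle_swap23; apply: lt_case.
- by apply/cocycle_swap23/cocycle_swap12; apply: lt_case.
- by apply: cocycle_swap12; apply: lt_case.
- by apply/cocycle_swap12/cocycle_swap23; apply: lt_case.
- by apply/cocycle_swap12/cocycle_swap23/cocycle_swap12; apply: lt_case.
Qed.

End OrderedCoordinates.

(** * Chart points and the points that they represent *)

Section Charts.
Variables (R : realType) (K : fieldType) (n : nat).
Implicit Types (sigma : set 'rV[R]_(n - 2)) (x : pairs n -> P1 K).
Implicit Types (a b c : 'I_(n - 2)) (m : 'rV[int]_(n - 2)).

Local Notation Sigma := (normal_fan (permutohedron R (n - 2))).
Local Notation chart := (chart_point K Sigma).

(** A chart point carries its cone only as a set; the preorder is recovered from the roots in the
    dual monoid. *)
Definition cone_order sigma : rel 'I_(n - 2) :=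
  fun a b => `[< dual_monoid sigma (root a b) >].

Lemma cone_orderK (le : rel 'I_(n - 2)) : total le -> transitive le ->
  cone_order (cone le) = le.
Proof.
move=> tot tr; apply/funext => a; apply/funext => b.
by apply/asboolP/idP => /(dual_cone_root R a b tot tr).
Qed.

Lemma fan_cone sigma : Sigma sigma ->
  [/\ total (cone_order sigma), transitive (cone_order sigma) &
      sigma = cone (cone_order sigma)].
Proof.
by move=> /normal_fan_permutohedron[le [tot tr ->]]; rewrite cone_orderK.
Qed.

Lemma affine_point_sum sigma (gamma : 'rV[int]_(n - 2) -> K) (I : Type)
    (r : seq I) (m : I -> 'rV[int]_(n - 2)) :
  affine_point sigma gamma -> (forall i, dual_monoid sigma (m i)) ->
  gamma (\sum_(i <- r) m i) = \prod_(i <- r) gamma (m i).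
Proof.
case=> g0 gD _ hm; elim: r => [|i r IH]; first by rewrite !big_nil.
by rewrite !big_cons gD ?IH //; apply: dual_monoid_sum.
Qed.

Lemma affine_pointMn sigma (gamma : 'rV[int]_(n - 2) -> K) m k :
  affine_point sigma gamma -> dual_monoid sigma m ->
  gamma (m *+ k) = gamma m ^+ k.
Proof.
case=> g0 gD _ hm; elim: k => [|k IH]; first by rewrite mulr0n g0.
by rewrite mulrS gD ?IH ?exprS //; apply: dual_monoidMn.
Qed.

Lemma affine_pointN sigma (gamma : 'rV[int]_(n - 2) -> K) m :
  affine_point sigma gamma -> dual_monoid sigma m -> dual_monoid sigma (- m) ->
  gamma m * gamma (- m) = 1.
Proof. by case=> g0 gD _ hm hm'; rewrite -gD // subrr. Qed.

(** The condition on the second coordinate excludes an infinite ratio, which division would silently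
    turn into [0]. *)
Definition represents (p : chart) x : Prop :=
  forall a b, cone_order (val p).1 a b ->
    (ratio x a b).2 != 0 /\
    (val p).2 (root a b) = (ratio x a b).1 / (ratio x a b).2.

Lemma chart_fan (p : chart) : Sigma (val p).1.
Proof. by have /asboolP[] := valP p. Qed.

Lemma chart_affine (p : chart) : affine_point (val p).1 (val p).2.
Proof. by have /asboolP[] := valP p. Qed.

(* For [z q < 0] the value [(c / c') ^ z q = (c' / c) ^ `|z q|] is also correct
   when [c' = 0], because then [c / c' = 0] and [0^-1 = 0]. *)
Lemma represents_monomial (p : chart) x (z : pairs n -> int) :
  represents p x -> adapted (cone_order (val p).1) z ->
  (val p).2 (\sum_q proot q *~ z q) =
  \prod_q ((hcoord (x q)).1 / (hcoord (x q)).2) ^ z q.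
Proof.
move=> rep hz; have ag := chart_affine p; have [g0 _ _] := ag.
have step q : dual_monoid (val p).1 (proot q *~ z q) /\
    (val p).2 (proot q *~ z q) = ((hcoord (x q)).1 / (hcoord (x q)).2) ^ z q.
  have [hpos hneg] := hz q; rewrite /proot -ratio_pair.
  case: (z q) hpos hneg => [[|k]|k] hpos hneg.
  - by rewrite mulr0z g0 expr0z; split=> //; apply: dual_monoid0.
  - have le_q := hpos isT; have [_ e] := rep _ _ le_q.
    move/asboolP: le_q => dq; split; first exact: dual_monoidMn.
    by rewrite -pmulrn (affine_pointMn _ ag) // e.
  - have le_q := hneg isT; have [_ e] := rep _ _ le_q.
    move/asboolP: le_q => dq; rewrite NegzE mulrNz -mulNrz rootN.
    split; first exact: dual_monoidMn.
    rewrite -pmulrn (affine_pointMn _ ag) // e ratio_sym /=.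
    by rewrite -exprz_inv invf_div.
rewrite (affine_point_sum _ ag) => [|q]; last by case: (step q).
by apply: eq_bigr => q _; case: (step q).
Qed.

Lemma fan_monomial (p : chart) m : dual_monoid (val p).1 m ->
  exists2 z, adapted (cone_order (val p).1) z & m = \sum_q proot q *~ z q.
Proof.
have [tot tr {1}->] := fan_cone (chart_fan p).
exact: dual_cone_generated.
Qed.

(** By totality each root or its opposite lies in the dual monoid, and either value determines the
    point of the projective line. *)
Lemma represents_inj (p : chart) x x' :
  represents p x -> represents p x' -> x = x'.
Proof.
move=> rep rep'; apply/funext => q.
rewrite -(hcoordK (x q)) -(hcoordK (x' q)).
apply/mkP1_eq; rewrite -?surjective_pairing ?hcoord_neq0 //.
have [tot _ _] := fan_cone (chart_fan p).
case/orP: (tot (pfst q) (psnd q)) => le_q.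
  have [n1 e1] := rep _ _ le_q; have [n2 e2] := rep' _ _ le_q.
  move: e1 n1 n2; rewrite e2 !ratio_pair => /eqP + n1 n2.
  by rewrite eqr_div // => /eqP <-; rewrite mulrC.
have [n1 e1] := rep _ _ le_q; have [n2 e2] := rep' _ _ le_q.
move: e1 n1 n2; rewrite e2 ![ratio _ (psnd q) _]ratio_sym !ratio_pair /=.
by move=> /eqP + n1 n2; rewrite eqr_div // => /eqP <-; rewrite mulrC.
Qed.

(** When the root is outside the dual monoid, totality puts its opposite inside, so the inverse
    ratio is available instead. *)
Definition chart_coord (p : chart) : pairs n -> P1 K := fun q =>
  if cone_order (val p).1 (pfst q) (psnd q) then mkP1 ((val p).2 (proot q)) 1
  else mkP1 1 ((val p).2 (- proot q)).

Lemma chart_coord_represents (p : chart) : represents p (chart_coord p).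
Proof.
have [tot _ _] := fan_cone (chart_fan p); have ag := chart_affine p.
have [g0 gD _] := ag.
have n1 (k : K) : ((k, 1) : K * K) != (0, 0) by rewrite xpair_eqE oner_eq0 andbF.
have n2 (k : K) : ((1, k) : K * K) != (0, 0) by rewrite xpair_eqE oner_eq0.
move=> a b ab; have [lt|lt|/val_inj e] := ltngtP a b.
- have [q qa qb] := pair_of_lt lt; move: ab; rewrite -qa -qb ratio_pair => ab.
  rewrite /chart_coord ab; have [k k0 ->] := hcoord_mkP1 (n1 ((val p).2 (proot q))).
  by rewrite mulr1 /= [k * _]mulrC mulfK.
- have [q qb qa] := pair_of_lt lt; move: ab; rewrite -qa -qb ratio_sym ratio_pair /=.
  move=> ab; rewrite /chart_coord; case: ifP => [ba|_].
    (* Both the root and its opposite are monomials here, so their values are mutually inverse and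
       the first branch also gives the reversed ratio. *)
    have [k k0 ->] := hcoord_mkP1 (n1 ((val p).2 (proot q))) => /=.
    have := affine_pointN ag (asboolW ba); rewrite rootN => /(_ (asboolW ab)) e1.
    have gq0 : (val p).2 (proot q) != 0.
      by apply/eqP => e0; move/eqP: e1; rewrite e0 mul0r eq_sym oner_eq0.
    rewrite mulf_neq0 //; split=> //.
    rewrite mulr1 invfM mulrA divff // mul1r; apply: (mulfI gq0).
    by rewrite divff.
  have [k k0 ->] := hcoord_mkP1 (n2 ((val p).2 (- proot q))) => /=.
  by rewrite mulr1 [k * _]mulrC mulfK // /proot rootN.
- by rewrite e ratio_refl root_refl g0 divr1 oner_eq0.
Qed.

(** On a chain of the preorder the relation is multiplicativity of the chart point; totality reduces
    every triple to a chain by transpositions. *)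
Lemma chart_coord_Fbar (p : chart) : Fbar_set (chart_coord p).
Proof.
move=> q s t qs qt st.
have ag := chart_affine p; have [g0 gD _] := ag.
have [tot tr _] := fan_cone (chart_fan p).
have rep : represents p (chart_coord p) by apply: chart_coord_represents.
set x := chart_coord p in rep *.
rewrite -!ratio_pair.
move/pfst_eq: qs => <-; move/psnd_pfst_eq: qt => <-; move/psnd_eq: st => <-.
move: (pfst q) (psnd q) (psnd s) => {q s t} a b c; rewrite -/(cocycle x a b c).
have fwd e f : cone_order (val p).1 e f ->
    (ratio x e f).1 = (val p).2 (root e f) * (ratio x e f).2.
  by move=> /rep[nz ->]; rewrite divfK.
have chain e f h : cone_order (val p).1 e f -> cone_order (val p).1 f h ->
    cocycle x e f h.
  move=> ef fh; rewrite /cocycle !fwd //; last exact: tr fh.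
  rewrite -(rootD e f h) gD; [ring|exact: asboolW ef|exact: asboolW fh].
case/orP: (tot a b) => [ab|ba]; case/orP: (tot b c) => [bc|cb].
- exact: chain.
- case/orP: (tot a c) => [ac|ca].
    by apply: cocycle_swap23; apply: chain.
  by apply/cocycle_swap23/cocycle_swap12; apply: chain.
- case/orP: (tot a c) => [ac|ca].
    by apply: cocycle_swap12; apply: chain.
  by apply/cocycle_swap12/cocycle_swap23; apply: chain.
- by apply/cocycle_swap12/cocycle_swap23/cocycle_swap12; apply: chain.
Qed.

End Charts.

(** * The chart point attached to the preorder of a point *)

Section OrbitChart.
Variables (R : realType) (K : fieldType) (n : nat).
Implicit Types (a b c : 'I_(n - 2)) (m : 'rV[int]_(n - 2)).

Local Notation Sigma := (normal_fan (permutohedron R (n - 2))).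
Local Notation chart := (chart_point K Sigma).

Variable x : pairs n -> P1 K.
Hypothesis Fx : Fbar_set x.

Definition finite_order : rel 'I_(n - 2) := fun a b => (ratio x a b).2 != 0.

Lemma finite_order_total : total finite_order.
Proof.
move=> a b; rewrite /finite_order ratio_sym /=.
by rewrite orbC; case: eqVneq => //= /ratio_fst_neq0 ->.
Qed.

(** If the ratio from [a] to [c] were infinite, the cocycle relation would equate [0] with a product
    of three nonzero coordinates. *)
Lemma finite_order_trans : transitive finite_order.
Proof.
move=> b a c ab bc; apply/eqP => ac0; have := Fbar_cocycle Fx a b c.
rewrite /cocycle ac0 mulr0 mul0r => /esym/eqP.
by rewrite !mulf_eq0 (negbTE ab) (negbTE bc) (negbTE (ratio_fst_neq0 ac0)).
Qed.

Lemma finite_order_refl a : finite_order a a.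
Proof. by case/orP: (finite_order_total a a). Qed.

Definition orbit_cone : set 'rV[R]_(n - 2) := cone finite_order.

Lemma orbit_cone_fan : Sigma orbit_cone.
Proof.
apply/normal_fan_permutohedron; exists finite_order; split=> //.
  exact: finite_order_total.
exact: finite_order_trans.
Qed.

(** The choice depends only on the predicate, so equivalent indices receive the same
    representative. *)
Definition class_repr a : 'I_(n - 2) :=
  odflt a [pick c | finite_order a c && finite_order c a].

Lemma class_reprP a :
  finite_order a (class_repr a) && finite_order (class_repr a) a.
Proof.
rewrite /class_repr; case: pickP => [c //|/(_ a)].
by rewrite finite_order_refl.
Qed.

Lemma class_repr_eq a b : finite_order a b -> finite_order b a ->
  class_repr a = class_repr b.
Proof.
move=> ab ba; rewrite /class_repr.
have e : (fun c => finite_order a c && finite_order c a) =1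
         (fun c => finite_order b c && finite_order c b).
  move=> c; apply/andP/andP => -[h h']; split;
    by [apply: finite_order_trans h|apply: finite_order_trans h'|
        apply: finite_order_trans ab|apply: finite_order_trans ba].
rewrite (eq_pick e); case: pickP => // /(_ b).
by rewrite finite_order_refl.
Qed.

(* The coordinate [z_a / z_r], with [r] the representative of the class of [a]:
   it is the value at [x] of a character up to the choice of a base point in
   each class. *)
Definition class_coord a : K :=
  (ratio x (class_repr a) a).1 / (ratio x (class_repr a) a).2.

Lemma class_coord_neq0 a : class_coord a != 0.
Proof.
have /andP[h h'] := class_reprP a; rewrite /class_coord mulf_neq0 ?invr_neq0 //.
by move: h; rewrite /finite_order ratio_sym.
Qed.

Lemma orbit_torus_subproof :
  [forall a, (\row_a class_coord a) 0 a != 0].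
Proof. by apply/forallP => a; rewrite mxE class_coord_neq0. Qed.

Definition orbit_torus : torus K (n - 2) :=
  exist (fun t : 'rV[K]_(n - 2) => [forall a, t 0 a != 0]) _
    orbit_torus_subproof.

Definition orbit_fun m : K :=
  if `[< dual_monoid orbit_cone m /\ dual_monoid orbit_cone (- m) >]
  then character orbit_torus m else 0.

(** Extension by zero stays multiplicative because a sum of two elements of the monoid is invertible
    only if both summands are. *)
Lemma orbit_affine : affine_point orbit_cone orbit_fun.
Proof.
rewrite /orbit_fun; split.
- by rewrite asboolT ?character0 // oppr0; split; apply: dual_monoid0.
- move=> m m' hm hm'; case: asboolP => [[h hN]|h].
    have subN (y y' z : 'rV[int]_(n - 2)) : dual_monoid orbit_cone y ->
        dual_monoid orbit_cone (- (y + y')) -> dual_monoid orbit_cone (- y').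
      move=> hy hyy; have -> : - y' = y + - (y + y').
        by rewrite opprD addrA subrr add0r.
      exact: dual_monoidD.
    rewrite !asboolT ?characterD //; split=> //.
      exact: subN hN.
    by apply: (subN _ _ 0 hm'); rewrite addrC.
  case: asboolP => [[_ hN]|_]; last by rewrite mul0r.
  case: asboolP => [[_ hN']|_]; last by rewrite mulr0.
  case: h; split; first exact: dual_monoidD.
  by rewrite opprD; apply: dual_monoidD.
- by move=> m hm; rewrite asboolF // => -[].
Qed.

Lemma orbit_chart_subproof : `[< Sigma orbit_cone /\ affine_point orbit_cone orbit_fun >].
Proof. by apply/asboolP; split; [apply: orbit_cone_fan|apply: orbit_affine]. Qed.

Definition orbit_chart : chart :=
  exist (fun p : set 'rV[R]_(n - 2) * ('rV[int]_(n - 2) -> K) =>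
           `[< Sigma p.1 /\ affine_point p.1 p.2 >])
    (orbit_cone, orbit_fun) orbit_chart_subproof.

Lemma character_root a b :
  character orbit_torus (root a b) = class_coord b / class_coord a.
Proof.
have delta c : character orbit_torus (delta_mx 0 c) = class_coord c.
  rewrite /character (bigD1 c) //= !mxE !eqxx expr1z big1 ?mulr1 // => e /negbTE ne.
  by rewrite !mxE ne andbF expr0z.
apply: (mulIf (class_coord_neq0 a)); rewrite divfK ?class_coord_neq0 //.
by rewrite -(delta a) -characterD /root subrK delta.
Qed.

(** For equivalent indices the cocycle relation through their common representative gives the ratio.
    Otherwise the ratio is [0], since a nonzero numerator would make the indices equivalent. *)
Lemma orbit_chart_represents : represents orbit_chart x.
Proof.
move=> a b /asboolP /= ab; have := ab.
rewrite /orbit_cone dual_cone_root; [|exact: finite_order_total|exact: finite_order_trans].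
move=> fab; split=> //; rewrite /orbit_fun; case: asboolP => [[_]|nab].
  rewrite rootN dual_cone_root; [|exact: finite_order_total|exact: finite_order_trans].
  move=> fba; rewrite character_root /class_coord (class_repr_eq fab fba).
  have /andP[hb hb'] := class_reprP b; set r := class_repr b in hb hb' *.
  have ha : finite_order r a by apply: finite_order_trans hb' fba.
  have ha' : finite_order a r by apply: finite_order_trans fab hb.
  have := Fbar_cocycle Fx r a b; rewrite /cocycle => e.
  have nra1 : (ratio x r a).1 != 0 by move: ha'; rewrite /finite_order ratio_sym.
  have nra2 : (ratio x r a).2 != 0 by [].
  have nrb2 : (ratio x r b).2 != 0 by [].
  have nab2 : (ratio x a b).2 != 0 by [].
  apply/eqP; rewrite invf_div mulf_div eqr_div ?mulf_neq0 //; apply/eqP.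
  by ring: e.
have -> : (ratio x a b).1 = 0; last by rewrite mul0r.
apply/eqP/negPn/negP => n1; apply: nab; split=> //.
rewrite rootN dual_cone_root; [|exact: finite_order_total|exact: finite_order_trans].
by rewrite /finite_order ratio_sym.
Qed.

(** The preorder of the chart is contained in [finite_order], so the cones are nested the other way;
    on common monomials both values are the same product of ratios of [x]. *)
Lemma represents_glued (p : chart) : represents p x -> glued p orbit_chart.
Proof.
move=> rep; have [tot tr ep] := fan_cone (chart_fan p).
have sub a b : cone_order (val p).1 a b -> finite_order a b by case/rep.
split=> [u hu|m]; first by rewrite ep => a b /sub/hu.
move=> /fan_monomial[z hz ->].
rewrite (represents_monomial rep hz) (represents_monomial orbit_chart_represents) //=.
move=> q; have [h1 h2] := hz q.
rewrite /orbit_cone cone_orderK; [|exact: finite_order_total|exact: finite_order_trans].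
by split=> [/h1/sub|/h2/sub].
Qed.

End OrbitChart.

(** * The bijection between the points of the two varieties *)

Section PointBijection.
Variables (R : realType) (K : fieldType) (n : nat).

Local Notation Sigma := (normal_fan (permutohedron R (n - 2))).
Local Notation chart := (chart_point K Sigma).
Local Notation XS := (toric_variety K Sigma).
Local Notation piS := (\pi_(toric_point K Sigma)).

(** Restriction carries representation from [q] to [p]. Conversely, [q] represents some point, which
    [p] then represents as well, and by uniqueness it is [x]. *)
Lemma glued_represents (p q : chart) x :
  glued p q -> represents p x <-> represents q x.
Proof.
move=> [sub eqf].
have mon m : dual_monoid (val p).1 m -> dual_monoid (val q).1 m.
  by move=> h u /sub/h.
have qp y : represents q y -> represents p y.
  move=> rep a b /asboolP ab; rewrite eqf //; apply: rep.
  by apply/asboolP; apply: mon.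
split; last exact: qp.
have rq := @chart_coord_represents R K n q.
by move=> /represents_inj/(_ (qp _ rq)) ->.
Qed.

Lemma pi_represents (p q : chart) x : piS p = piS q ->
  represents p x -> represents q x.
Proof.
move=> /eqP; rewrite eqmodE => /asboolP.
move=> e; suff : represents p x <-> represents q x by case.
elim: e => [{}p {}q /(@glued_represents _ _ x) //|//|{}p {}q _ <- //|].
by move=> {}p r {}q _ -> _ ->.
Qed.

Definition Fbar_in (x : Fbar K n) : Fbar_set (val x) := set_mem (valP x).

Definition to_toric (x : Fbar K n) : XS := piS (orbit_chart R (Fbar_in x)).

Definition of_toric (y : XS) : Fbar K n :=
  exist (fun z => z \in @Fbar_set K n) _
    (mem_set (chart_coord_Fbar (repr (y : toric_point K Sigma)))).

Lemma to_toric_pi (p : chart) (x : Fbar K n) : represents p (val x) ->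
  to_toric x = piS p.
Proof.
move=> rep; apply/esym/eqP; rewrite eqmodE; apply/asboolP/rst_step.
exact: represents_glued.
Qed.

Lemma pi_to_toric (p : chart) (x : Fbar K n) : to_toric x = piS p ->
  represents p (val x).
Proof. by move=> e; apply: (pi_represents e); apply: orbit_chart_represents. Qed.

Lemma of_toric_pi (p : chart) : represents p (val (of_toric (piS p))).
Proof.
apply: (@pi_represents (repr (piS p))); first by rewrite reprK.
exact: chart_coord_represents.
Qed.

Lemma to_toricK : cancel to_toric of_toric.
Proof.
move=> x; apply: val_inj; apply: (@represents_inj R K n (orbit_chart R (Fbar_in x))).
  exact: of_toric_pi.
exact: orbit_chart_represents.
Qed.

Lemma of_toricK : cancel of_toric to_toric.
Proof.
move=> y; rewrite -[y in RHS](reprK (y : toric_point K Sigma)).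
apply: to_toric_pi.
by rewrite -[y in of_toric y](reprK (y : toric_point K Sigma)); apply: of_toric_pi.
Qed.

End PointBijection.

(** * The tori and their actions *)

Section Equivariance.
Variables (R : realType) (K : fieldType) (n : nat).
Implicit Types (a b c : 'I_(n - 2)).

Local Notation Sigma := (normal_fan (permutohedron R (n - 2))).

(* Forgetting the coordinate [0] identifies the root lattice with Z^(n-3). *)
Definition forget_first : 'M[int]_(n - 2, n - 3) :=
  \matrix_(i, j) (val i == (val j).+1)%:R.

(** The lineality space is the line of constant vectors: these lie in every cone, and the cone of
    the trivial preorder contains no others. *)
Lemma character_latticeE m :
  character_lattice Sigma m <-> \sum_a m 0 a = 0.
Proof.
have Sigma_line : Sigma (cone (fun _ _ => true)).
  by apply/normal_fan_permutohedron; exists (fun _ _ => true).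
split=> [h|sum0 u hu].
  apply: (@dual_cone_sum0 _ R (fun _ _ => true)) => u hu; apply: h => sigma.
  by move=> /fan_cone[_ _ ->] a b _; apply: hu.
have cst a b : u 0 a = u 0 b.
  by apply: le_anti; rewrite !(hu _ Sigma_line _ _ isT).
rewrite /dotp; case: (pickP (@predT 'I_(n - 2))) => [a0 _|none]; last first.
  by rewrite big1 // => i; have := none i.
under eq_bigr do rewrite (cst _ a0) mxE.
by rewrite -mulr_sumr -rmorph_sum sum0 mulr0.
Qed.

(** The sum condition determines the forgotten coordinate; a preimage is a combination of the roots
    issuing from index [0]. *)
Lemma character_lattice_bij (hn : (4 <= n)%N) :
  set_bij (character_lattice Sigma) [set: 'rV[int]_(n - 3)]
          (fun m => mulmx m forget_first).
Proof.
have succ_bound (j : 'I_(n - 3)) : (j.+1 < n - 2)%N by have := ltn_ord j; lia.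
have zero_bound : (0 < n - 2)%N by lia.
pose o : 'I_(n - 2) := Ordinal zero_bound.
pose su j : 'I_(n - 2) := Ordinal (succ_bound j).
have entry (m : 'rV[int]_(n - 2)) j : (m *m forget_first) 0 j = m 0 (su j).
  rewrite mxE (bigD1 (su j)) //= mxE eqxx mulr1 big1 ?addr0 // => i ni.
  by rewrite mxE -[(_ == _)]/(i == su j) (negbTE ni) mulr0.
have cases i : i = o \/ exists j, i = su j.
  case: (posnP i) => [i0|i0]; [left; exact: val_inj|right].
  have h : (i.-1 < n - 3)%N by have := ltn_ord i; lia.
  by exists (Ordinal h); apply: val_inj => /=; lia.
split=> //.
- move=> m m'; rewrite !inE => /character_latticeE sm /character_latticeE sm' e.
  have es j : m 0 (su j) = m' 0 (su j) by rewrite -!entry e.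
  apply/rowP => i; have [->|[j ->]//] := cases i.
  move: sm sm'; rewrite (bigD1 o) //= [X in _ -> X = _ -> _](bigD1 o) //=.
  have -> : \sum_(i < n - 2 | i != o) m 0 i = \sum_(i < n - 2 | i != o) m' 0 i.
    apply: eq_bigr => k; have [->|[j ->]//] := cases k.
    by rewrite eqxx.
  by move=> /eqP + /eqP; rewrite !addr_eq0 => /eqP -> /eqP ->.
- move=> z _; exists (\sum_j z 0 j *: root o (su j)) => [|/=].
    have sum_delta c : \sum_i (delta_mx 0 c : 'rV[int]_(n - 2)) 0 i = 1.
      rewrite (bigD1 c) //= mxE !eqxx big1 ?addr0 // => i /negbTE ni.
      by rewrite mxE ni andbF.
    apply/character_latticeE; under eq_bigr do rewrite summxE.
    rewrite exchange_big big1 // => j _ /=.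
    under eq_bigr do rewrite mxE.
    rewrite -mulr_sumr -[RHS](mulr0 (z 0 j)); congr (_ * _).
    rewrite -[RHS](subrr 1) -{1}(sum_delta (su j)) -(sum_delta o) -sumrB.
    by apply: eq_bigr => i _; rewrite !mxE.
  apply/rowP => j; rewrite entry summxE (bigD1 j) //= big1 => [|k kj].
    by rewrite addr0 !mxE !eqxx /= subr0 mulr1.
  rewrite !mxE -[su j == su k]/(val j == val k) (inj_eq val_inj) eq_sym.
  by rewrite (negbTE kj) subr0 mulr0.
Qed.

Variable t : torus K (n - 3).

(** Adjoining the coordinate [1] at index [0] lets both cases of [rho] become quotients of
    weights. *)
Definition weight a : K := if val a == 0 then 1 else tcoord t (val a).

Lemma weight_neq0 a : weight a != 0.
Proof. by rewrite /weight; case: ifP => _; rewrite ?oner_neq0 ?tcoord_neq0. Qed.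

Lemma character_root_forget a b :
  character t (root a b *m forget_first) = weight b / weight a.
Proof.
have delta c : character t (delta_mx 0 c *m forget_first) = weight c.
  rewrite /character -rowE /weight; case: ifPn => c0.
    by rewrite big1 // => j _; rewrite !mxE (eqP c0) expr0z.
  (* [tcoord] counts from 1 and the matrix columns from 0, so index [c] corresponds to column
     [c.-1]. *)
  have h : (c.-1 < n - 3)%N by have := ltn_ord c; move: c0 => /=; lia.
  rewrite /tcoord insubT /= (bigD1 (Ordinal h)) //= big1 => [|j nj].
    by rewrite !mxE /= prednK ?lt0n // eqxx expr1z mulr1.
  rewrite !mxE; case: eqP => [e|_]; last exact: expr0z.
  by case/negP: nj; apply/eqP/val_inj; rewrite /= e.
apply: (mulIf (weight_neq0 a)); rewrite divfK ?weight_neq0 //.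
by rewrite -(delta a) -characterD -mulmxDl /root subrK delta.
Qed.

Lemma rho_weight p : rho t p = weight (psnd p) / weight (pfst p).
Proof.
have /andP[h3 hlt] := valP p.
rewrite /rho /weight /= -/(fst_index p) -/(snd_index p).
have -> : (snd_index p - 3 == 0)%N = false by apply/eqP; rewrite /snd_index; lia.
have -> : (fst_index p - 3 == 0)%N = (fst_index p == 3)%N.
  by apply/eqP/eqP; rewrite /fst_index; lia.
by case: ifP => _; rewrite ?divr1.
Qed.

Lemma ratio_act x a b : exists2 k, k != 0 &
  ratio (Fbar_act_fun t x) a b =
  (k * (weight b / weight a * (ratio x a b).1), k * (ratio x a b).2).
Proof.
have pair q : exists2 k, k != 0 & hcoord (Fbar_act_fun t x q) =
    (k * (weight (psnd q) / weight (pfst q) * (hcoord (x q)).1),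
     k * (hcoord (x q)).2).
  rewrite -rho_weight; apply: hcoord_mkP1.
  have := hcoord_neq0 (x q); apply: contra.
  rewrite !xpair_eqE mulf_eq0 (negbTE (rho_neq0 t q)) /= => h.
  by rewrite [hcoord _]surjective_pairing xpair_eqE.
have wa := weight_neq0 a; have wb := weight_neq0 b.
have [ab|ba|/val_inj ->] := ltngtP a b.
- have [q <- <-] := pair_of_lt ab; rewrite !ratio_pair; exact: pair.
- have [q qb qa] := pair_of_lt ba; have [k k0] := pair q.
  rewrite ![ratio _ a b]ratio_sym -qb -qa !ratio_pair => -> /=.
  (* Reversing the pair moves the character to the second coordinate, where the common scalar
     absorbs it. *)
  exists (k * (weight (psnd q) / weight (pfst q))).
    by rewrite !mulf_neq0 ?invr_neq0 ?weight_neq0.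
  by congr (_, _); field; rewrite !weight_neq0.
- exists 1; first exact: oner_neq0.
  by rewrite !ratio_refl divff ?weight_neq0 // !mul1r.
Qed.

(** It suffices that the translate of a chart point representing [x] represents the translate of
    [x], which is checked on roots. *)
Lemma to_toric_act (x : Fbar K n) :
  to_toric R (Fbar_act t x) =
  toric_act (dual_torus _ forget_first t) (to_toric R x).
Proof.
apply: to_toric_pi => a b /= ab.
set p := repr (to_toric R x : toric_point K Sigma) in ab *.
have rep : represents p (val x).
  by apply: pi_to_toric; rewrite /p reprK.
have [nz e] := rep _ _ ab.
have [k k0 ->] := ratio_act (val x) a b; rewrite /= mulf_neq0 //; split=> //.
rewrite e /dual_torus_fun asboolT; last first.
  by move=> u hu; apply: (asboolW ab); apply: hu; apply: chart_fan.
by rewrite character_root_forget -mulf_div divff // mul1r mulrA.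
Qed.

End Equivariance.

(** * Regularity *)

(** Open sets and regular functions are generated locally by fractions, so only fractions have to be
    pulled back. *)
Lemma morphism_local (K : Type) (X Y : variety K) (phi : X -> Y) :
  (forall D g x, fraction D g -> D (phi x) -> exists D' g',
     [/\ fraction D' g', D' x & forall y, D' y -> D (phi y) /\ g' y = g (phi y)]) ->
  morphism phi.
Proof.
move=> loc V openV; split.
  move=> x /openV[D [g [frac Dx DV]]].
  have [D' [g' [frac' D'x sub]]] := loc _ _ _ frac Dx.
  by exists D', g'; split=> // y /sub[/DV].
move=> f regf x /regf[D [g [frac Dx eqf]]].
have [D' [g' [frac' D'x sub]]] := loc _ _ _ frac Dx.
exists D', g'; split=> // y /sub[Dy ->] Vy; exact: eqf.
Qed.

Lemma expr_clear (K : fieldType) (c c' : K) (e D : nat) : c' != 0 ->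
  (e <= D)%N -> c ^+ e * c' ^+ (D - e) = c' ^+ D * (c / c') ^+ e.
Proof.
move=> nz le_e; rewrite expr_div_n -[in RHS](subnK le_e) exprD -mulrA.
by rewrite [X in _ = _ * X]mulrC divfK ?expf_neq0 // mulrC.
Qed.

Section Morphisms.
Variables (R : realType) (K : fieldType) (n : nat).

Local Notation Sigma := (normal_fan (permutohedron R (n - 2))).
Local Notation chart := (chart_point K Sigma).
Local Notation piS := (\pi_(toric_point K Sigma)).
Implicit Types (sigma : set 'rV[R]_(n - 2)) (x : pairs n -> P1 K).

(** This is the monomial after division, for each [q], by the [D q]-th power of a homogeneous
    coordinate that is nonzero throughout the chart. *)
Definition pulled_monomial sigma (D : pairs n -> nat) (e : {ffun pairs n -> nat}) :
    'rV[int]_(n - 2) :=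
  \sum_q (if cone_order sigma (pfst q) (psnd q) then proot q *+ e q
          else (- proot q) *+ (D q - e q)).

Definition pulled sigma D (g : seq (K * {ffun pairs n -> nat})) :=
  [seq (ae.1, pulled_monomial sigma D ae.2) | ae <- g].

Lemma pulled_monomial_dual sigma D e : Sigma sigma ->
  forall q, dual_monoid sigma
    (if cone_order sigma (pfst q) (psnd q) then proot q *+ e q
     else (- proot q) *+ (D q - e q)).
Proof.
move=> /fan_cone[tot _ _] q; have := tot (pfst q) (psnd q).
case: ifP => [/asboolW h _|_ /= /asboolW h]; apply: dual_monoidMn => //.
by rewrite /proot rootN.
Qed.

Lemma pulled_function sigma D g : Sigma sigma ->
  chart_function sigma (pulled sigma D g).
Proof.
move=> Ss am /mapP[ae _ ->] /=.
by apply: dual_monoid_sum; apply: pulled_monomial_dual.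
Qed.

(** The factor [k] is the product of the powers divided out. It does not depend on [g], so it
    cancels in fractions. *)
Lemma mh_eval_pulled (p : chart) x D : represents p x ->
  exists2 k, k != 0 & forall g, multihomogeneous D g ->
    mh_eval D g x = k * chart_eval (pulled (val p).1 D g) (val p).2.
Proof.
move=> rep; have [tot _ _] := fan_cone (chart_fan p); have ag := chart_affine p.
exists (\prod_q (if cone_order (val p).1 (pfst q) (psnd q)
                 then (hcoord (x q)).2 else (hcoord (x q)).1) ^+ D q).
  apply/prodf_neq0 => q _; apply: expf_neq0; case: ifP => h.
    by have [] := rep _ _ h; rewrite ratio_pair.
  have := tot (pfst q) (psnd q); rewrite h /= => /rep[].
  by rewrite ratio_sym ratio_pair.
move=> g hg; rewrite /mh_eval /chart_eval big_map mulr_sumr big_seq [RHS]big_seq.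
apply: eq_bigr => ae /hg hae /=; rewrite mulrCA; congr (_ * _).
rewrite (affine_point_sum _ ag); last exact: pulled_monomial_dual (chart_fan p).
rewrite -big_split; apply: eq_bigr => q _ /=.
have := hae q; set e := ae.2 q => le_e.
case: ifP => h.
  have [nz er] := rep _ _ h; rewrite (affine_pointMn _ ag) ?er; last exact: asboolW h.
  move: nz; rewrite ratio_pair => nz.
  exact: expr_clear.
have := tot (pfst q) (psnd q); rewrite h /= => {}h.
have [nz er] := rep _ _ h.
rewrite /proot rootN (affine_pointMn _ ag) ?er; last exact: asboolW h.
move: nz; rewrite ratio_sym ratio_pair /= => nz.
by rewrite -expr_clear ?leq_subr // subKn // mulrC.
Qed.

Lemma of_toric_morphism : morphism (@of_toric R K n).
Proof.
apply: morphism_local => U f y [D [g [h [hg hh eU ef]]]] Uy.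
set p := repr (y : toric_point K Sigma).
have Ss := chart_fan p; set sigma := (val p).1 in Ss.
have ev (q : chart) : (val q).1 = sigma -> exists2 k, k != 0 &
    forall g', multihomogeneous D g' ->
    mh_eval D g' (val (of_toric (piS q))) =
    k * chart_eval (pulled sigma D g') (val q).2.
  by move=> <-; apply: mh_eval_pulled; apply: of_toric_pi.
have inU (q : chart) : (val q).1 = sigma ->
   (U (of_toric (piS q)) <-> chart_eval (pulled sigma D h) (val q).2 != 0).
  move=> /ev[k k0 evk]; rewrite eU /= evk // mulf_eq0 (negbTE k0).
  by [].
exists [set piS q | q in [set q : chart |
          (val q).1 = sigma /\ chart_eval (pulled sigma D h) (val q).2 != 0]].
exists (f \o @of_toric R K n); split.
- exists sigma, (pulled sigma D g), (pulled sigma D h).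
  split=> //; [exact: pulled_function|exact: pulled_function|].
  move=> q eq nz /=; rewrite ef; last by apply/inU.
  have [k k0 evk] := ev q eq; rewrite !evk // -mulf_div divff // mul1r.
  by [].
- exists p; last by rewrite /p reprK.
  by split=> //; apply/inU => //; rewrite /p reprK.
- by move=> _ [q [eq nz] <-]; split=> //; apply/inU.
Qed.

End Morphisms.

(** * Regularity of the map to the toric variety, by clearing denominators *)

Section ToToricMorphism.
Variables (R : realType) (K : fieldType) (n : nat).

Local Notation Sigma := (normal_fan (permutohedron R (n - 2))).
Local Notation chart := (chart_point K Sigma).
Local Notation piS := (\pi_(toric_point K Sigma)).
Implicit Types (x : pairs n -> P1 K) (m : 'rV[int]_(n - 2)).

(** The cone of [x] lies in [sigma], so [orbit_fun] restricts to the smaller dual monoid of [sigma];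
    outside it the value is reset to [0]. *)
Lemma represents_in_cone sigma x : Fbar_set x -> Sigma sigma ->
  (forall a b, cone_order sigma a b -> (ratio x a b).2 != 0) ->
  exists2 p : chart, (val p).1 = sigma & represents p x.
Proof.
move=> Fx Ss sub; have [_ _ es] := fan_cone Ss.
have sub_cone : orbit_cone (R := R) x `<=` sigma.
  by move=> u hu; rewrite es => a b /sub; apply: hu.
have sub_dual m : dual_monoid sigma m -> dual_monoid (orbit_cone (R := R) x) m.
  by move=> h u /sub_cone/h.
have [o0 oD _] := orbit_affine R x.
pose gamma m := if `[< dual_monoid sigma m >] then orbit_fun R x m else 0.
have ag : affine_point sigma gamma.
  split=> [|m m' hm hm'|m hm]; rewrite /gamma.
  - by rewrite asboolT //; apply: dual_monoid0.
  - by rewrite !asboolT ?oD //; [apply: sub_dual|apply: sub_dual|apply: dual_monoidD].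
  - by rewrite asboolF.
have hp : `[< Sigma (sigma, gamma).1 /\
              affine_point (sigma, gamma).1 (sigma, gamma).2 >].
  exact/asboolP.
exists (exist (fun p : set 'rV[R]_(n - 2) * ('rV[int]_(n - 2) -> K) =>
           `[< Sigma p.1 /\ affine_point p.1 p.2 >]) _ hp) => //.
move=> a b /= ab; rewrite /gamma asboolT; last exact: asboolW ab.
have h : cone_order (val (orbit_chart R Fx)).1 a b.
  by apply/asboolP/sub_dual; apply: asboolW ab.
exact: (@orbit_chart_represents R K n x Fx a b h).
Qed.

Variables (sigma : set 'rV[R]_(n - 2)) (Ss : Sigma sigma).
Variables (expo : 'rV[int]_(n - 2) -> pairs n -> int) (M : nat).
Hypothesis M_gt0 : (0 < M)%N.
Hypothesis expoP : forall m, dual_monoid sigma m ->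
  adapted (cone_order sigma) (expo m) /\ m = \sum_q proot q *~ expo m q.

(* The Laurent monomial [\prod_q (c_q / c'_q) ^ expo m q] is multiplied by
   [\prod_q c_q ^ (2 * pole_num q) * c'_q ^ (2 * pole_den q)]. The factor 2
   makes the result vanish as soon as one coordinate that has to be invertible
   on the chart of [sigma] is zero. *)
Definition pole_den q := if cone_order sigma (pfst q) (psnd q) then M else 0%N.
Definition pole_num q := if cone_order sigma (psnd q) (pfst q) then M else 0%N.
Definition pole_degree q : nat := ((pole_num q).*2 + (pole_den q).*2)%N.

Definition cleared_monomial m : {ffun pairs n -> nat} :=
  [ffun q => absz ((pole_num q).*2%:Z + expo m q)].

Definition cleared (g : seq (K * 'rV[int]_(n - 2))) :=
  [seq (am.1, cleared_monomial am.2) | am <- g].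

Definition bounded (g : seq (K * 'rV[int]_(n - 2))) : Prop :=
  forall am, am \in g -> forall q, (`|expo am.2 q| <= M)%N.

(** One copy of each pole order absorbs the exponent, which is at most [M] in absolute value; the
    other copy survives as a factor of the cleared monomial. *)
Lemma cleared_bounds m q : dual_monoid sigma m -> (`|expo m q| <= M)%N ->
  [/\ (cleared_monomial m q)%:Z = (pole_num q).*2%:Z + expo m q,
      (cleared_monomial m q <= pole_degree q)%N,
      (pole_num q <= cleared_monomial m q)%N &
      (pole_den q <= pole_degree q - cleared_monomial m q)%N].
Proof.
move=> /expoP[/(_ q)[hpos hneg] _] hM; rewrite ffunE /pole_degree.
have pos : 0 < expo m q -> pole_den q = M by rewrite /pole_den => /hpos ->.
have neg : expo m q < 0 -> pole_num q = M by rewrite /pole_num => /hneg ->.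
have [z0|z0|z0] := ltrgtP (expo m q) 0.
- by have := neg z0; split; lia.
- by have := pos z0; split; lia.
- by rewrite z0; split; lia.
Qed.

Lemma cleared_multihomogeneous g : chart_function sigma g -> bounded g ->
  multihomogeneous pole_degree (cleared g).
Proof.
move=> hg bg ae /mapP[am amg ->] q /=.
by have [] := cleared_bounds (hg _ amg) (bg _ amg q).
Qed.

Lemma cleared_neq0 g x : chart_function sigma g -> bounded g ->
  mh_eval pole_degree (cleared g) x != 0 ->
  forall a b, cone_order sigma a b -> (ratio x a b).2 != 0.
Proof.
move=> hg bg nz; suff pair q :
    (cone_order sigma (pfst q) (psnd q) -> (hcoord (x q)).2 != 0) /\
    (cone_order sigma (psnd q) (pfst q) -> (hcoord (x q)).1 != 0).
  move=> a b; have [ab|ba|/val_inj ->] := ltngtP a b.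
  - by have [q <- <-] := pair_of_lt ab; rewrite ratio_pair; case: (pair q).
  - have [q <- <-] := pair_of_lt ba; rewrite ratio_sym ratio_pair /=.
    by case: (pair q).
  - by rewrite ratio_refl oner_eq0.
split=> ord; apply: contra_neq nz => c0; rewrite /mh_eval big_map big_seq big1 //.
  move=> am amg /=; have [_ _ _ le_den] := cleared_bounds (hg _ amg) (bg _ amg q).
  rewrite (bigD1 q) //= c0 [in X in _ * (X * _)]expr0n.
  move: le_den; rewrite /pole_den ord; case: eqP => [->|_ _]; first lia.
  by rewrite mulr0 mul0r mulr0.
move=> am amg /=; have [_ _ le_num _] := cleared_bounds (hg _ amg) (bg _ amg q).
rewrite (bigD1 q) //= c0 expr0n.
move: le_num; rewrite /pole_num ord; case: eqP => [->|_ _]; first lia.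
by rewrite !mul0r mulr0.
Qed.

Lemma laurent_clear (c c' : K) (z : int) (s t e : nat) :
  e%:Z = s%:Z + z -> (e <= s + t)%N -> (0 < z -> c' != 0) -> (z < 0 -> c != 0) ->
  c ^+ e * c' ^+ (s + t - e) = c ^+ s * c' ^+ t * (c / c') ^ z.
Proof.
case: z => [[|k]|k] ez le_e hpos hneg.
- have -> : e = s by lia.
  by rewrite addKn expr0z mulr1.
- have nz := hpos isT; have -> : e = (s + k.+1)%N by lia.
  have -> : t = (s + t - (s + k.+1) + k.+1)%N by lia.
  set r := (s + t - (s + k.+1))%N.
  have -> : (s + (r + k.+1) - (s + k.+1) = r)%N by lia.
  rewrite -exprnP expr_div_n !exprD; field.
  by rewrite expf_neq0.
- have nz := hneg isT; have -> : s = (e + k.+1)%N by lia.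
  have -> : (e + k.+1 + t - e = t + k.+1)%N by lia.
  rewrite NegzE -exprnN -exprVn invf_div expr_div_n !exprD; field.
  by rewrite expf_neq0.
Qed.

Lemma mh_eval_cleared (p : chart) x : (val p).1 = sigma -> represents p x ->
  exists2 k, k != 0 & forall g, chart_function sigma g -> bounded g ->
    mh_eval pole_degree (cleared g) x = k * chart_eval g (val p).2.
Proof.
move=> ep rep.
have nz2 q : cone_order sigma (pfst q) (psnd q) -> (hcoord (x q)).2 != 0.
  by rewrite -ep => /rep[]; rewrite ratio_pair.
have nz1 q : cone_order sigma (psnd q) (pfst q) -> (hcoord (x q)).1 != 0.
  by rewrite -ep => /rep[]; rewrite ratio_sym ratio_pair.
exists (\prod_q ((hcoord (x q)).1 ^+ (pole_num q).*2 *
                 (hcoord (x q)).2 ^+ (pole_den q).*2)).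
  apply/prodf_neq0 => q _; rewrite mulf_neq0 //.
    rewrite /pole_num; case: ifP => [/nz1 h|_]; first exact: expf_neq0.
    by rewrite expr0 oner_neq0.
  rewrite /pole_den; case: ifP => [/nz2 h|_]; first exact: expf_neq0.
  by rewrite expr0 oner_neq0.
move=> g hg bg; rewrite /mh_eval /chart_eval big_map mulr_sumr big_seq [RHS]big_seq.
apply: eq_bigr => am amg /=; rewrite mulrCA; congr (_ * _).
have [hz em] := expoP (hg _ amg).
rewrite [in RHS]em (represents_monomial rep) ?ep // -big_split; apply: eq_bigr => q _ /=.
have [e1 e2 _ _] := cleared_bounds (hg _ amg) (bg _ amg q).
have [hpos hneg] := hz q.
by apply: laurent_clear => // [/hpos/nz2|/hneg/nz1].
Qed.

End ToToricMorphism.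

Section Isomorphism.
Variables (R : realType) (K : fieldType) (n : nat).

Local Notation Sigma := (normal_fan (permutohedron R (n - 2))).
Local Notation chart := (chart_point K Sigma).
Local Notation piS := (\pi_(toric_point K Sigma)).

Lemma to_toric_morphism : morphism (@to_toric R K n).
Proof.
apply: morphism_local => U f x [sigma [g [h [Ss hg hh eU ef]]]].
rewrite eU => -[p [ep nz]] e0.
have rep : represents p (val x) by apply: pi_to_toric; rewrite e0.
have /boolp.choice[expo expoP] : forall m : 'rV[int]_(n - 2),
    exists z : pairs n -> int, dual_monoid sigma m ->
      adapted (cone_order sigma) z /\ m = \sum_q proot q *~ z q.
  move=> m.
  have [hm|hm] := pselect (dual_monoid sigma m); last by exists (fun=> 0).
  have := @fan_monomial R K n p m; rewrite ep => /(_ hm)[z hz em].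
  by exists z.
(* A single bound for [g] and [h] gives numerator and denominator the same multidegree; the
   successor makes it positive. *)
pose M := (\max_(am <- g ++ h) \max_q absz (expo am.2 q))%N.+1.
have bnd am : am \in g ++ h -> forall q, (`|expo am.2 q| <= M)%N.
  move=> amgh q; apply: leqW.
  pose F (am : K * 'rV[int]_(n - 2)) := (\max_q absz (expo am.2 q))%N.
  apply: leq_trans (@leq_bigmax_seq _ _ xpredT F am amgh isT).
  exact: (@leq_bigmax _ (fun q => absz (expo am.2 q)) q).
have bg : bounded expo M g by move=> am ag; apply: bnd; rewrite mem_cat ag.
have bh : bounded expo M h by move=> am ah; apply: bnd; rewrite mem_cat ah orbT.
have M0 : (0 < M)%N by [].
pose D := pole_degree sigma M.
pose gX := cleared sigma expo M g; pose hX := cleared sigma expo M h.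
exists [set y : Fbar K n | mh_eval D hX (val y) != 0].
exists (fun y : Fbar K n => mh_eval D gX (val y) / mh_eval D hX (val y)).
split.
- exists D, gX, hX; split=> //; exact: cleared_multihomogeneous.
- have [k k0 ev] := mh_eval_cleared M0 expoP ep rep.
  by rewrite /= /hX ev // mulf_neq0.
(* Nonvanishing of the cleared denominator places [y] in the chart of [sigma], where the common
   factor [k] cancels. *)
- move=> y /= hy; have sub := cleared_neq0 M0 expoP hh bh hy.
  have [q eq repq] := represents_in_cone (Fbar_in y) Ss sub.
  have [k k0 ev] := mh_eval_cleared M0 expoP eq repq.
  have nzq : chart_eval h (val q).2 != 0.
    by move: hy; rewrite /hX ev // mulf_eq0 negb_or => /andP[].
  rewrite (to_toric_pi repq); split; first by exists q.
  by rewrite ef // /gX /hX !ev // -mulf_div divff // mul1r.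
Qed.

Lemma to_toric_isomorphism : isomorphism (@to_toric R K n).
Proof.
exists (@of_toric R K n); split.
- exact: to_toricK.
- exact: of_toricK.
- exact: to_toric_morphism.
- exact: of_toric_morphism.
Qed.

End Isomorphism.

Theorem theorem19 (R : realType) (n : nat) (hn : (4 <= n)%N) :
  exists (A : 'M[int]_(n - 2, n - 3))
         (phi : Fbar R[i] n ->
                toric_variety R[i] (normal_fan (permutohedron R (n - 2)))),
    [/\ set_bij (character_lattice (normal_fan (permutohedron R (n - 2))))
                [set: 'rV[int]_(n - 3)] (fun m => mulmx m A),
        isomorphism phi &
        forall (t : torus R[i] (n - 3)) (x : Fbar R[i] n),
          phi (Fbar_act t x) = toric_act (dual_torus _ A t) (phi x)].
Proof.
exists (forget_first n), (@to_toric R _ n); split.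
- exact: character_lattice_bij.
- exact: to_toric_isomorphism.
- exact: to_toric_act.
Qed.
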